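(* Consider the Boolean clustering problem $\mathbf{P}_{\mathrm{B}}$ in dimension $d$ with $\lambda=Cd^{-1/4}$ for a sufficiently large absolute constant $C>0$. Then: (1) There is an algorithm $\mathcal{A}$ that, given a single sample ($n=1$), satisfies $\mathrm{err}(\mathcal{A},\mathbf{P}_{\mathrm{B}})\le0.01$. (2) For every $\alpha<1/2$ and every algorithm $\mathcal{A}:(\{\pm1\}^d)^n\to\mathcal{M}$ with $\mathrm{err}(\mathcal{A},\mathbf{P}_{\mathrm{B}})\le\alpha$, \[ \mathrm{mem}_n(\mathcal{A},\mathbf{P}_{\mathrm{B}})=\Omega\!\left(\frac{1-8\lambda^2n\log(dn\log|\mathcal{M}|/C_\alpha)}{\lambda^4n\log(dn\log|\mathcal{M}|/C_\alpha)}C_\alpha\right),\qquad C_\alpha:=(1-2\alpha)\log\frac{1-\alpha}{\alpha}. \] In particular, if $n\le c\sqrt d/\log(d\log(|\mathcal{M}|)/C_\alpha)$ for a sufficiently small absolute constant $c>0$ and $|\mathcal{M}|\le\exp(d^{\tilde C})$ for an absolute constant $\tilde C>0$ fixed in advance, then \[ \mathrm{mem}_n(\mathcal{A},\mathbf{P}_{\mathrm{B}})=\Omega\!\left(\frac{1-8\lambda^2n\log(dn/C_\alpha)}{\lambda^4n\log(dn/C_\alpha)}C_\alpha\right), \] and for $\alpha=1/3$ this is $\widetilde\Omega(d/n)$. (3) If $n\le\sqrt d$, there is an algorithm $\mathcal{A}$ with $\mathrm{err}(\mathcal{A},\mathbf{P}_{\mathrm{B}})\le0.01$ and $\mathrm{mem}_n(\mathcal{A},\mathbf{P}_{\mathrm{B}})=O(d/n)$.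 Moreover, for every $n$ there is an algorithm $\mathcal{A}$ with $\mathrm{err}(\mathcal{A},\mathbf{P}_{\mathrm{B}})\le0.01$ and $\mathrm{mem}_n(\mathcal{A},\mathbf{P}_{\mathrm{B}})=O(d^2n\exp(-n/\sqrt d))$; in particular, if $n\gtrsim\sqrt d\log d$ then $\mathrm{mem}_n(\mathcal{A},\mathbf{P}_{\mathrm{B}})\le1/\mathrm{poly}(d)$.
   Context: Boolean clustering problem $\mathbf{P}_{\mathrm{B}}$: $\theta\sim\Psi=\mathcal{U}(\{\pm1\}^d)$ (uniform), $\mathcal{P}_\theta=\mathrm{BSC}_{(1-\lambda)/2}(\theta)$, where for $x\in\{\pm1\}^d$ and $p\in[0,1]$, $\mathrm{BSC}_p(x)$ is the product distribution of $Y\in\{\pm1\}^d$ with $\Pr[Y_i\ne x_i]=p$ independently for each $i$; the null distribution is $\mathcal{P}_0=\mathcal{U}(\{\pm1\}^d)$. An algorithm receives $X_{1:n}\sim\mathcal{P}_\theta^n$ and outputs a classifier $h:\{\pm1\}^d\to\{0,1\}$ from a set $\mathcal{M}$. $\mathrm{err}(h)=\tfrac12\Pr_{X\sim\mathcal{P}_\theta}[h(X)=0]+\tfrac12\Pr_{X\sim\mathcal{P}_0}[h(X)=1]$, $\mathrm{err}(\mathcal{A},\mathbf{P})=\mathbb{E}_{\theta,X_{1:n},h\leftarrow\mathcal{A}(X_{1:n})}[\mathrm{err}(h)]$, $\mathrm{mem}_n(\mathcal{A},\mathbf{P})=I(\mathcal{A}(X_{1:n});X_{1:n}\mid\theta)$.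 $\widetilde\Omega$ hides logarithmic factors; asymptotic notation hides absolute constants. *)

(* Defs.v *)
From HB Require Import structures.
From mathcomp Require Import all_boot all_order all_algebra.
From mathcomp Require Import reals sequences exp.
Set Implicit Arguments. Unset Strict Implicit. Unset Printing Implicit Defensive.
Import Order.TTheory GRing.Theory Num.Theory.
Local Open Scope ring_scope.

(* Points of {+1,-1}^d are encoded as boolean vectors: true = +1, false = -1. *)
Definition cube (d : nat) := {ffun 'I_d -> bool}.
Definition classifier (d : nat) := {ffun cube d -> bool}.
Definition sample (d n : nat) := {ffun 'I_n -> cube d}.

Section Defs.
Variable R : realType.

Definition unif_pmf (d : nat) (x : cube d) : R := (2 ^+ d)^-1.

Definition bsc_pmf (d : nat) (lam : R) (th x : cube d) : R :=
  \prod_(i < d) (if x i == th i then 1 - (1 - lam) / 2 else (1 - lam) / 2).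

Definition iid_pmf (d n : nat) (p : cube d -> R) (X : sample d n) : R :=
  \prod_(j < n) p (X j).

Definition is_algo (d n : nat) (A : sample d n -> classifier d -> R) : Prop :=
  forall X, (forall h, 0 <= A X h) /\ \sum_h A X h = 1.

Definition outputs_in (d n : nat) (A : sample d n -> classifier d -> R)
  (M : {set classifier d}) : Prop :=
  forall X h, h \notin M -> A X h = 0.

Definition err_h (d : nat) (lam : R) (th : cube d) (h : classifier d) : R :=
  2^-1 * (\sum_x bsc_pmf lam th x * (~~ h x)%:R)
  + 2^-1 * (\sum_x unif_pmf x * (h x)%:R).

Definition err_alg (d n : nat) (lam : R) (A : sample d n -> classifier d -> R) : R :=
  \sum_th unif_pmf th *
    (\sum_X iid_pmf (bsc_pmf lam th) X * (\sum_h A X h * err_h lam th h)).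

Definition out_marg (d n : nat) (lam : R) (A : sample d n -> classifier d -> R)
  (th : cube d) (h : classifier d) : R :=
  \sum_X iid_pmf (bsc_pmf lam th) X * A X h.

(* I(A(X_{1:n}); X_{1:n} | theta = th), natural logarithm; terms with zero
   joint probability contribute 0 (they are multiplied by 0). *)
Definition mi_given (d n : nat) (lam : R) (A : sample d n -> classifier d -> R)
  (th : cube d) : R :=
  \sum_X \sum_h iid_pmf (bsc_pmf lam th) X * A X h *
     ln (A X h / out_marg lam A th h).

Definition memo (d n : nat) (lam : R) (A : sample d n -> classifier d -> R) : R :=
  \sum_th unif_pmf th * mi_given lam A th.

Definition C_alpha (alpha : R) : R := (1 - 2 * alpha) * ln ((1 - alpha) / alpha).

Definition lam_of (C : R) (d : nat) : R := C * powR (d%:R) (- 4^-1).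

End Defs.

(* Main.v *)
Require Import Defs.
From HB Require Import structures.
From mathcomp Require Import all_boot all_order all_algebra.
From mathcomp Require Import reals sequences exp.
From mathcomp Require Import ring lra.
Import Order.TTheory GRing.Theory Num.Theory.
Local Open Scope ring_scope.
Set Implicit Arguments. Unset Strict Implicit. Unset Printing Implicit Defensive.

(** Lower bound.  For a fixed output [h], the kernel entry [A X h] is the density
    of the conditional law of the sample given [h], so all mutual informations
    are sums over [h] of entropies [ent p f = E f ln f - E f ln E f], and
    I(A; X | theta) = I(A; X) - I(A; theta).  The backward channel from the
    sample to theta is a product over coordinates, and one coordinate satisfies a
    strong data-processing inequality with constant O(lambda^2 n), because the
    posterior mean of a bit given its [n] noisy copies is subgaussian with that
    variance proxy; hence I(A; theta) <= O(lambda^2 n) I(A; X).  In the same way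
    I(A; test point) <= O(lambda^2) I(A; theta), while a classifier of error
    alpha separates the joint law of (A, test point) from the product law and so
    forces I(A; test point) >= c C_alpha.

    Upper bound.  Take coordinatewise majorities of the sample on a set [D] of
    coordinates and threshold the correlation of the test point with them.  The
    majorities have bias of order min(1, lambda sqrt n), so [d / n] coordinates
    suffice when n <= sqrt d; for n >= sqrt d all majorities are right, and the
    output is determined by theta, except with exponentially small probability. *)

(** * Entropy of densities *)

Section Entropy.
Variable R : realType.
Implicit Types (V W I : finType) (a b t x y : R).

(** The contraction step pays no logarithm. The posterior mean of a bit is controlled through its
    averaged exponential moment, and this works as long as [n%:R * lam ^+ 2 <= 1]: the shift n
    lambda of the mean of a column sum then stays within its spread sqrt n. With rho = O(lambda^2
    n), the term I(A; theta) occurs on both sides of the contraction and is absorbed, giving (1 -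
    rho) I(A; theta) <= rho I(A; X | theta), hence a log-free lower bound for small lambda^2 n.

    The logarithmic form follows. Either its numerator is nonpositive, or 8 lambda^2 n L < 1
    together with L >= 90 forces lambda^2 n < 1/720. That L >= 90 is itself an information bound:
    small error forces C_alpha = O(ln |M|), so the argument of L is at least of order d, and d >=
    C^4 is huge.

    Entropies are taken of unnormalised functions, so that convexity and the chain rule apply for
    each output separately, without dividing by its probability. *)

Definition expect V (p f : V -> R) : R := \sum_v p v * f v.

(** Homogeneous in [f]: it equals [expect p f] times the relative entropy, with respect to [p], of
    the law with density [f / expect p f]. *)
Definition ent V (p f : V -> R) : R :=
  expect p (fun v => f v * ln (f v)) - expect p f * ln (expect p f).

Definition mix W V (r : W -> R) (K : W -> V -> R) (v : V) : R :=
  \sum_w r w * K w v.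

Lemma expect_ge0 V (p f : V -> R) :
  (forall v, 0 <= p v) -> (forall v, 0 <= f v) -> 0 <= expect p f.
Proof. by move=> p0 f0; apply: sumr_ge0 => v _; apply: mulr_ge0. Qed.

Lemma eq_expect V (p f g : V -> R) : f =1 g -> expect p f = expect p g.
Proof. by move=> fg; apply: eq_bigr => v _; rewrite fg. Qed.

Lemma eq_ent V (p q f g : V -> R) : p =1 q -> f =1 g -> ent p f = ent q g.
Proof.
move=> pq fg; have e : expect p f = expect q g.
  by apply: eq_bigr => v _; rewrite pq fg.
rewrite /ent e; congr (_ - _).
by apply: eq_bigr => v _; rewrite pq fg.
Qed.

Lemma expect_sum V I (p : V -> R) (P : pred I) (f : I -> V -> R) :
  expect p (fun v => \sum_(i | P i) f i v) = \sum_(i | P i) expect p (f i).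
Proof.
rewrite /expect exchange_big; apply: eq_bigr => v _.
by rewrite mulr_sumr.
Qed.

Lemma expectZ V (p f : V -> R) a :
  expect p (fun v => a * f v) = a * expect p f.
Proof. by rewrite /expect mulr_sumr; apply: eq_bigr => v _; rewrite mulrCA. Qed.

Lemma expectB V (p f g : V -> R) :
  expect p (fun v => f v - g v) = expect p f - expect p g.
Proof. by rewrite /expect -sumrB; apply: eq_bigr => v _; rewrite mulrBr. Qed.

Lemma expectD V (p f g : V -> R) :
  expect p (fun v => f v + g v) = expect p f + expect p g.
Proof. by rewrite /expect -big_split; apply: eq_bigr => v _; rewrite mulrDr. Qed.

Lemma expect_cst V (p : V -> R) a : \sum_v p v = 1 -> expect p (fun=> a) = a.
Proof. by move=> p1; rewrite /expect -mulr_suml p1 mul1r. Qed.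

Lemma ler_expect V (p f g : V -> R) :
  (forall v, 0 <= p v) -> (forall v, f v <= g v) -> expect p f <= expect p g.
Proof. by move=> p0 fg; apply: ler_sum => v _; apply: ler_wpM2l. Qed.

Lemma expect_mix W V (r : W -> R) (K : W -> V -> R) f :
  expect (mix r K) f = expect r (fun w => expect (K w) f).
Proof.
rewrite /expect /mix; under eq_bigr do rewrite mulr_suml.
rewrite exchange_big; apply: eq_bigr => w _; rewrite mulr_sumr.
by apply: eq_bigr => v _; rewrite mulrA.
Qed.

Lemma ln_le_subr1 x : 0 < x -> ln x <= x - 1.
Proof. by move=> x0; rewrite -{1}(subrKC 1 x) le_ln1Dx// ltrBrDl subrr. Qed.

(** Averages ln y <= y - 1 at y = F w / (W f), where F and W are the means of [f] and [w]; the
    linear terms cancel. The support condition compensates for the convention [ln 0 = 0], which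
    would otherwise replace minus infinity by 0. *)
Lemma gibbs V (p f w : V -> R) :
  (forall v, 0 <= p v) -> (forall v, 0 <= f v) -> (forall v, 0 <= w v) ->
  (forall v, w v = 0 -> f v = 0) ->
  expect p (fun v => f v * ln (w v)) <= ent p f + expect p f * ln (expect p w).
Proof.
move=> p0 f0 w0 wf; have F0 := expect_ge0 p0 f0; have W0 := expect_ge0 p0 w0.
rewrite /ent; move: F0; rewrite le_eqVlt => /orP[/eqP F0|F0].
  have pf v : p v * f v = 0.
    have /psumr_eq0P : \sum_v p v * f v = 0 by rewrite -[LHS]/(expect p f) -F0.
    by apply=> // i _; apply: mulr_ge0.
  rewrite -F0 !mul0r subr0 addr0 /expect !big1 // => v _;
    by rewrite mulrA pf mul0r.
have W1 : 0 < expect p w.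
  rewrite lt_neqAle W0 andbT eq_sym; apply/negP => /eqP W1.
  have pw v : p v * w v = 0.
    have /psumr_eq0P : \sum_v p v * w v = 0 by rewrite -[LHS]/(expect p w).
    by apply=> // i _; apply: mulr_ge0.
  suff : expect p f = 0 by move=> e; rewrite e ltxx in F0.
  apply: big1 => v _; move: (pw v) => /eqP; rewrite mulf_eq0 => /orP[] /eqP e.
    by rewrite e mul0r.
  by rewrite wf // mulr0.
set F := expect p f in F0 *; set W := expect p w in W1 *.
suff h : expect p (fun v => f v * ln (w v)) <=
    expect p (fun v => (f v * ln (f v) - (ln F - ln W) * f v) +
                       (F / W * w v - f v)).
  apply: (le_trans h); rewrite expectD !expectB !expectZ -/F -/W.
  rewrite le_eqVlt; apply/orP; left; apply/eqP.
  by field; rewrite gt_eqF.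
apply: ler_expect => // v.
case: (eqVneq (f v) 0) => [->|fv].
  by rewrite !mul0r mulr0 subrr add0r subr0 mulr_ge0 // divr_ge0 // ltW.
have fv0 : 0 < f v by rewrite lt_neqAle eq_sym fv f0.
have wv0 : 0 < w v.
  by rewrite lt_neqAle w0 andbT eq_sym; apply: contra fv => /eqP/wf ->.
have := @ln_le_subr1 (F / W * w v / f v) (divr_gt0 (mulr_gt0 (divr_gt0 F0 W1) wv0) fv0).
rewrite !(ln_div, lnM) ?posrE ?mulr_gt0 ?divr_gt0 ?invr_gt0 //.
move=> h; have := ler_wpM2l (f0 v) h.
have -> : f v * (F / W * w v / f v - 1) = F / W * w v - f v.
  by field; rewrite fv gt_eqF.
lra.
Qed.

(** The case [w = expR g] of [gibbs]; positivity of the exponential makes the support condition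
    void. *)
Lemma donsker_varadhan V (p f g : V -> R) :
  (forall v, 0 <= p v) -> (forall v, 0 <= f v) ->
  expect p (fun v => f v * g v) <=
    ent p f + expect p f * ln (expect p (fun v => expR (g v))).
Proof.
move=> p0 f0; have := @gibbs V p f (fun v => expR (g v)) p0 f0.
rewrite (@eq_expect _ _ (fun v => f v * ln (expR (g v))) (fun v => f v * g v)); last first.
  by move=> v; rewrite expRK.
apply=> [v|v /eqP]; first exact: expR_ge0.
by rewrite expR_eq0.
Qed.


Lemma ent_ge0 V (p f : V -> R) :
  (forall v, 0 <= p v) -> \sum_v p v = 1 -> (forall v, 0 <= f v) -> 0 <= ent p f.
Proof.
move=> p0 p1 f0; have := @donsker_varadhan V p f (fun=> 0) p0 f0.
rewrite expect_cst // expR0 ln1 mulr0 addr0; apply: le_trans.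
by apply: expect_ge0 => // v; rewrite mulr0.
Qed.

(** By [gibbs], entropy is a supremum of linear functionals. Each [f i] is tested against the same
    function, the mixture [G], which is optimal for [G] itself. *)
Lemma ent_convex V I (p : V -> R) (c : I -> R) (f : I -> V -> R) :
  (forall v, 0 <= p v) -> (forall i, 0 <= c i) -> (forall i v, 0 <= f i v) ->
  ent p (fun v => \sum_i c i * f i v) <= \sum_i c i * ent p (f i).
Proof.
move=> p0 c0 f0; set G := fun v => _.
have G0 v : 0 <= G v by apply: sumr_ge0 => i _; apply: mulr_ge0.
rewrite /ent lerBlDr.
have -> : expect p (fun v => G v * ln (G v)) =
          \sum_i c i * expect p (fun v => f i v * ln (G v)).
  under eq_bigr => i _ do rewrite -expectZ.
  rewrite -expect_sum; apply: eq_expect => v.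
  by rewrite {1}/G mulr_suml; apply: eq_bigr => i _; rewrite mulrA.
have -> : expect p G * ln (expect p G) =
          \sum_i c i * (expect p (f i) * ln (expect p G)).
  rewrite {1}/G expect_sum mulr_suml; apply: eq_bigr => i _.
  by rewrite expectZ mulrA.
rewrite -big_split /=; apply: ler_sum => i _; rewrite -mulrDr.
(* Only an index of nonzero weight has its support inside that of [G]. *)
case: (eqVneq (c i) 0) => [->|ci]; first by rewrite !mul0r.
apply: ler_wpM2l => //; apply: gibbs => // v Gv.
move/eqP: Gv; rewrite /G psumr_eq0 => [/allP/(_ i (mem_index_enum _))|j _]; last exact: mulr_ge0.
by rewrite /= mulf_eq0 (negbTE ci) => /eqP.
Qed.

(** Chain rule for a Markov chain W, V, output: I(V; out) = I(V; out | W) + I(W; out), for one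
    output. *)
Lemma ent_mix W V (r : W -> R) (K : W -> V -> R) (f : V -> R) :
  ent (mix r K) f =
  expect r (fun w => ent (K w) f) + ent r (fun w => expect (K w) f).
Proof. by rewrite /ent !expect_mix expectB; ring. Qed.

End Entropy.

(** * Strong data-processing inequalities *)

Section ProductMeasure.
Variable R : realType.
Implicit Types (V W I : finType).

Definition prodm I V (k : I -> V -> R) (Y : {ffun I -> V}) : R :=
  \prod_i k i (Y i).

Lemma prodm_ge0 I V (k : I -> V -> R) Y :
  (forall i v, 0 <= k i v) -> 0 <= prodm k Y.
Proof. by move=> k0; apply: prodr_ge0. Qed.

Lemma sum_prodm I V (k : I -> V -> R) : \sum_Y prodm k Y = \prod_i \sum_v k i v.
Proof. by rewrite bigA_distr_bigA. Qed.

Lemma sum_prodm1 I V (k : I -> V -> R) :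
  (forall i, \sum_v k i v = 1) -> \sum_Y prodm k Y = 1.
Proof. by move=> k1; rewrite sum_prodm big1. Qed.

Lemma mix_prodm I V W (r : I -> W -> R) (K : I -> W -> V -> R) (Y : {ffun I -> V}) :
  mix (prodm r) (fun w : {ffun I -> W} => prodm (fun i => K i (w i))) Y =
  prodm (fun i => mix (r i) (K i)) Y.
Proof.
rewrite /prodm bigA_distr_bigA; apply: eq_bigr => w _.
by rewrite -big_split.
Qed.

Definition fcons d V (v : V) (F : {ffun 'I_d -> V}) : {ffun 'I_d.+1 -> V} :=
  [ffun i => oapp F v (unlift ord0 i)].

Lemma fcons0 d V (v : V) (F : {ffun 'I_d -> V}) : fcons v F ord0 = v.
Proof. by rewrite ffunE unlift_none. Qed.

Lemma fconsS d V (v : V) (F : {ffun 'I_d -> V}) i : fcons v F (lift ord0 i) = F i.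
Proof. by rewrite ffunE liftK. Qed.

Lemma sum_fcons d V (G : {ffun 'I_d.+1 -> V} -> R) :
  \sum_F G F = \sum_v \sum_F G (fcons v F).
Proof.
rewrite pair_big /=.
rewrite (reindex (fun p : V * {ffun 'I_d -> V} => fcons p.1 p.2)) //=.
exists (fun F => (F ord0, [ffun i => F (lift ord0 i)])) => [[v F] _|F _] /=.
  by rewrite fcons0; congr pair; apply/ffunP => i; rewrite ffunE fconsS.
apply/ffunP => i; case: (unliftP ord0 i) => [j|] ->; last by rewrite fcons0.
by rewrite fconsS ffunE.
Qed.

Lemma prodm_fcons d V (k : 'I_d.+1 -> V -> R) v F :
  prodm k (fcons v F) = k ord0 v * prodm (fun i => k (lift ord0 i)) F.
Proof.
rewrite /prodm big_ord_recl fcons0; congr (_ * _).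
by apply: eq_bigr => i _; rewrite fconsS.
Qed.

(** Chain rule that splits off the first coordinate: the intermediate term, the mean of E ln E over
    the first coordinate, cancels. It drives the induction of [sdpi_prodm]. *)
Lemma ent_prodm_fcons d V (p : V -> R) (f : {ffun 'I_d.+1 -> V} -> R) :
  ent (prodm (fun=> p)) f =
  expect p (fun v => ent (prodm (fun=> p)) (fun F => f (fcons v F))) +
  ent p (fun v => expect (prodm (fun=> p)) (fun F => f (fcons v F))).
Proof.
have E g : expect (prodm (fun=> p)) g =
    expect p (fun v => expect (prodm (fun=> p)) (fun F => g (fcons v F))).
  rewrite /expect sum_fcons; apply: eq_bigr => v _; rewrite mulr_sumr.
  by apply: eq_bigr => F _; rewrite prodm_fcons mulrA.
by rewrite /ent E [in X in _ - X]E expectB; ring.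
Qed.

Lemma sum_ffun_ord0 V (G : {ffun 'I_0 -> V} -> R) (F0 : {ffun 'I_0 -> V}) :
  \sum_F G F = G F0.
Proof.
by rewrite (big_pred1 F0) // => F; apply/esym/eqP/ffunP => -[].
Qed.

(* The strong data-processing inequality for the channel [K] read backwards from
   output to input, in density form. *)
Definition sdpi W V (rho : R) (r : W -> R) (K : W -> V -> R) : Prop :=
  forall f : V -> R, (forall v, 0 <= f v) ->
  ent r (fun w => expect (K w) f) <= rho * ent (mix r K) f.

(** Tensorization without loss in the constant. The chain rule splits both entropies at the first
    coordinate. The conditional parts are compared by convexity and induction, the marginal parts by
    the one-coordinate inequality. *)
Lemma sdpi_prodm d W V (rho : R) (r : W -> R) (K : W -> V -> R) :
  0 <= rho -> (forall w, 0 <= r w) -> \sum_w r w = 1 ->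
  (forall w v, 0 <= K w v) -> (forall w, \sum_v K w v = 1) ->
  sdpi rho r K ->
  sdpi rho (prodm (fun _ : 'I_d => r)) (fun w => prodm (fun i => K (w i))).
Proof.
move=> rho0 r0 r1 K0 K1 rK.
have p0 v : 0 <= mix r K v by apply: sumr_ge0 => w _; apply: mulr_ge0.
have p1 : \sum_v mix r K v = 1.
  rewrite /mix exchange_big /= -[RHS]r1; apply: eq_bigr => w _.
  by rewrite -mulr_sumr K1 mulr1.
move=> f f0; rewrite (eq_ent (mix_prodm (fun=> r) (fun=> K)) (fun=> erefl)).
elim: d f f0 => [|d IH] f f0.
  have [F0 _|] := pickP (fun _ : {ffun 'I_0 -> W} => true); last first.
    move=> /(_ [ffun i : 'I_0 => match i with Ordinal _ p => match notF p with end end]).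
    by [].
  have -> (g : {ffun 'I_0 -> W} -> R) : ent (prodm (fun=> r)) g = 0.
    by rewrite /ent /expect !(sum_ffun_ord0 _ F0) /prodm !big_ord0 !mul1r subrr.
  apply: mulr_ge0 => //; apply: ent_ge0 => // [v|].
    exact: prodr_ge0.
  exact: sum_prodm1.
rewrite !ent_prodm_fcons mulrDr.
set p := mix r K; set pn := prodm (fun _ : 'I_d => p).
set rn := prodm (fun _ : 'I_d => r).
set Kn := fun w : {ffun 'I_d -> W} => prodm (fun i => K (w i)).
have KE a b : expect (prodm (fun i => K (fcons a b i))) f =
    expect (K a) (fun x => expect (Kn b) (fun y => f (fcons x y))).
  rewrite /expect sum_fcons; apply: eq_bigr => x _; rewrite mulr_sumr.
  apply: eq_bigr => y _; rewrite prodm_fcons fcons0 mulrA; congr (_ * _ * _).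
  by apply: eq_bigr => i _; rewrite fconsS.
apply: lerD.
  apply: (@le_trans _ _ (expect r (fun a => expect (K a)
      (fun x => rho * ent pn (fun y => f (fcons x y)))))).
    (* Given the input [a], the first output [x] is averaged inside the entropy; convexity moves the
       average outside, and the induction hypothesis applies at each fixed [x]. *)
    apply: ler_expect => // a; rewrite (eq_ent (fun=> erefl) (KE a)).
    apply: (le_trans (ent_convex _ _ _)) => //.
    - by move=> b; apply: prodm_ge0.
    - by move=> x b; apply: expect_ge0 => // y; apply: prodm_ge0.
    by apply: ler_sum => x _; apply: ler_wpM2l => //; apply: IH.
  rewrite -expect_mix expectZ.
  exact: lexx.
(* Averaging over the other inputs turns their channels into the output marginal [pn], which leaves
   a function of the first output alone. *)
have -> : ent r (fun a => expect rn (fun b => expect (prodm (fun i => K (fcons a b i))) f)) =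
    ent r (fun a => expect (K a) (fun x => expect pn (fun y => f (fcons x y)))).
  apply: eq_ent => // a; rewrite (eq_expect _ (KE a)) expect_sum.
  apply: eq_bigr => x _; rewrite expectZ -expect_mix; congr (_ * _).
  by apply: eq_bigr => y _; rewrite (mix_prodm (fun=> r) (fun=> K)).
by apply: rK => x; apply: expect_ge0 => // y; apply: prodm_ge0.
Qed.

Lemma expR_mul_le (x : R) : x < 1 -> expR x * (1 - x) <= 1.
Proof.
move=> x1; have x0 : 0 < 1 - x by rewrite subr_gt0.
rewrite -[leRHS](expRxMexpNx_1 x) ler_pM2l ?expR_gt0 //.
exact: expR_ge1Dx.
Qed.

(** The sharp exponent is x^2 / 2; the factor 2 admits elementary bounds. For |x| <= 1/2, cosh x <=
    1 / (1 - x^2) <= 1 + 2 x^2; otherwise |x| <= 2 x^2 bounds each exponential. *)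
Lemma cosh_le_expR (x : R) : expR x + expR (- x) <= 2 * expR (2 * x ^+ 2).
Proof.
have [x1|x1] := lerP (x ^+ 2) (2^-1 ^+ 2).
  have xa : `|x| <= 2^-1.
    by move: x1; rewrite -real_normK ?num_real // ler_sqr ?nnegrE ?invr_ge0.
  have [h1 h2] : x <= 2^-1 /\ - 2^-1 <= x by move: xa; rewrite ler_norml => /andP[].
  have e1 : expR x * (1 - x) <= 1 by apply: expR_mul_le; lra.
  have e2 : expR (- x) * (1 + x) <= 1.
    by rewrite -[x in 1 + x]opprK; apply: expR_mul_le; lra.
  have e3 := expR_ge1Dx (2 * x ^+ 2).
  apply: (@le_trans _ _ (2 * (1 + 2 * x ^+ 2))); last by rewrite ler_pM2l.
  have h3 : 0 <= x ^+ 2 by apply: sqr_ge0.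
  have d0 : 0 < 1 - x ^+ 2 by rewrite subr_gt0; lra.
  rewrite -(ler_pM2r d0).
  apply: (@le_trans _ _ 2).
    have := @ler_wpM2r _ (1 + x) _ _ _ e1; have := @ler_wpM2r _ (1 - x) _ _ _ e2.
    move=> /(_ ltac:(lra)) e4 /(_ ltac:(lra)) e5.
    have -> : (expR x + expR (- x)) * (1 - x ^+ 2) =
       expR x * (1 - x) * (1 + x) + expR (- x) * (1 + x) * (1 - x) by ring.
    lra.
  set y := x ^+ 2 in x1 h3 *.
  have : y * (1 - 2 * y) >= 0 by apply: mulr_ge0 => //; lra.
  rewrite -subr_ge0 => h.
  rewrite -subr_ge0; have -> : 2 * (1 + 2 * y) * (1 - y) - 2 = 2 * (y * (1 - 2 * y) - 0) by ring.
  lra.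
have h : `|x| <= 2 * x ^+ 2.
  rewrite -real_normK ?num_real //.
  have : 2^-1 < `|x|.
    by move: x1; rewrite -[x ^+ 2]real_normK ?num_real // ltr_sqr ?nnegrE ?invr_ge0.
  move=> h1; have := ler_wpM2l (normr_ge0 x) (ltW h1).
  by rewrite expr2; lra.
have a y : y <= `|x| -> expR y <= expR (2 * x ^+ 2).
  by move=> yx; rewrite ler_expR (le_trans yx).
have := a _ (ler_norm x); have := a (- x); rewrite -normrN => /(_ (ler_norm _)).
lra.
Qed.

(** For 0 <= x <= y the difference of the two sides factors as (e^y - e^x) (1 - e^(-x-y)). *)
Lemma cosh_homo (x y : R) : `|x| <= `|y| ->
  expR x + expR (- x) <= expR y + expR (- y).
Proof.
have c z : expR z + expR (- z) = expR `|z| + expR (- `|z|).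
  by case: (ger0P z) => _; rewrite ?opprK // addrC.
move=> xy; rewrite [leLHS]c [leRHS]c; move: `|x| `|y| (normr_ge0 x) (normr_ge0 y) xy => {c}{}x {}y x0 y0 xy.
have -> : expR (- x) = expR y * expR (- x - y) by rewrite -expRD; congr expR; ring.
have -> : expR (- y) = expR x * expR (- x - y) by rewrite -expRD; congr expR; ring.
have h1 : expR x <= expR y by rewrite ler_expR.
have h2 : expR (- x - y) <= 1 by rewrite expR_le1; lra.
have : 0 <= (expR y - expR x) * (1 - expR (- x - y)) by apply: mulr_ge0; rewrite subr_ge0.
lra.
Qed.

(** The quotient is tanh (y / 2); this form is the one in which posterior means appear. *)
Lemma ler_tanh (y : R) : `|(expR y - 1) / (expR y + 1)| <= `|y|.
Proof.
wlog y0 : y / 0 <= y => [h|].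
  have [/h //|y0] := lerP 0 y.
  have := h (- y); rewrite normrN => /(_ ltac:(lra)).
  have -> : (expR (- y) - 1) / (expR (- y) + 1) = - ((expR y - 1) / (expR y + 1)).
    have e0 := expR_gt0 y; rewrite expRN; field.
    by repeat (apply/andP; split); apply: lt0r_neq0; lra.
  by rewrite normrN.
have e0 := expR_gt0 y; have e1 : 1 <= expR y by rewrite -expR0 ler_expR.
rewrite !ger0_norm //; last by apply: divr_ge0; lra.
rewrite ler_pdivrMr; last by lra.
have : 1 - y <= expR (- y) by have := expR_ge1Dx (- y).
move=> /(ler_wpM2l (ltW e0)); rewrite expRxMexpNx_1; lra.
Qed.

Lemma xlnx_le (x F : R) : 0 <= x -> 0 < F -> x * ln x <= x * ln F + x * (x / F - 1).
Proof.
move=> x0 F0; have [->|xn] := eqVneq x 0; first by rewrite !mul0r addr0.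
have x1 : 0 < x by rewrite lt_neqAle eq_sym xn.
have := ln_le_subr1 (divr_gt0 x1 F0); rewrite ln_div // => /(ler_wpM2l x0).
lra.
Qed.

Definition half (b : bool) : R := 2^-1.

Lemma sum_half : \sum_b half b = 1.
Proof. rewrite big_bool /= /half; lra. Qed.

Lemma expect_half (g : bool -> R) : expect half g = (g true + g false) / 2.
Proof. by rewrite /expect big_bool /= /half; lra. Qed.

(* If the posterior mean [m] of a uniform bit is subgaussian, its square is
   controlled by the entropy of the tilting density through Donsker-Varadhan. *)
Lemma sdpi_bit V (a : R) (K : bool -> V -> R) (m : V -> R) :
  0 < a -> (forall b v, 0 <= K b v) -> (forall b, \sum_v K b v = 1) ->
  (forall v, mix half K v * m v = (K true v - K false v) / 2) ->
  (forall t, expect (mix half K) (fun v => expR (t * m v)) <= expR (a * t ^+ 2)) ->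
  sdpi (4 * a) half K.
Proof.
move=> a0 K0 K1 hm sg f f0.
set A := expect (K true) f; set B := expect (K false) f.
have A0 : 0 <= A by apply: expect_ge0.
have B0 : 0 <= B by apply: expect_ge0.
have p0 v : 0 <= mix half K v.
  by apply: sumr_ge0 => b _; apply: mulr_ge0 => //; rewrite invr_ge0.
have p1 : \sum_v mix half K v = 1.
  rewrite /mix exchange_big -[RHS]sum_half; apply: eq_bigr => b _.
  by rewrite -mulr_sumr K1 mulr1.
have EF : expect (mix half K) f = (A + B) / 2.
  by rewrite expect_mix expect_half.
have Em : expect (mix half K) (fun v => f v * m v) = (A - B) / 2.
  rewrite /A /B /expect -sumrB mulr_suml; apply: eq_bigr => v _.
  by rewrite [f v * _]mulrC mulrA hm; ring.
have -> : ent half (fun w => expect (K w) f) =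
   (A * ln A + B * ln B) / 2 - (A + B) / 2 * ln ((A + B) / 2).
  by rewrite /ent !expect_half.
have [F0|F1] := eqVneq ((A + B) / 2) 0.
  have -> : A = 0 by lra.
  have -> : B = 0 by lra.
  rewrite addr0 !mul0r addr0 mul0r subrr.
  by apply: mulr_ge0; [lra|apply: ent_ge0].
set F := (A + B) / 2 in EF F1 *; set D := (A - B) / 2 in Em.
have F0 : 0 < F by rewrite lt_neqAle eq_sym F1 /F; lra.
(* Entropy is at most variance over mean; here the two values are [F + D] and [F - D]. *)
have up : (A * ln A + B * ln B) / 2 - F * ln F <= D ^+ 2 / F.
  have := xlnx_le A0 F0; have := xlnx_le B0 F0.
  have -> : D ^+ 2 / F = (A * (A / F - 1) + B * (B / F - 1)) / 2.
    have EA : A = F + D by rewrite /F /D; lra.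
    have EB : B = F - D by rewrite /F /D; lra.
    by rewrite EA EB; field.
  have : (A + B) * ln F = 2 * (F * ln F) by rewrite /F; lra.
  lra.
apply: (le_trans up).
(* The maximiser of [t * D - F * (a * t ^+ 2)], with maximum D^2 / (4 a F). *)
pose t := D / (2 * a * F).
have := donsker_varadhan (fun v => t * m v) p0 f0.
rewrite (@eq_expect _ _ _ _ (fun v => t * (f v * m v))) => [|v]; last by rewrite mulrCA.
rewrite expectZ Em EF => dv.
have Z0 : 0 < expect (mix half K) (fun v => expR (t * m v)).
  apply: (@lt_le_trans _ _ (expect (mix half K) (fun v => expR (- `|t| * \sum_u `|m u|)))).
    by rewrite expect_cst ?expR_gt0.
  apply: ler_expect => // v; rewrite ler_expR mulNr lerNl.
  apply: (le_trans (ler_norm _)); rewrite normrN normrM ler_wpM2l //.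
  by rewrite (bigD1 v) //= lerDl sumr_ge0.
have : ln (expect (mix half K) (fun v => expR (t * m v))) <= a * t ^+ 2.
  by rewrite -ler_expR lnK.
move=> /(ler_wpM2l (ltW F0)) h.
have -> : D ^+ 2 / F = 4 * a * (t * D - F * (a * t ^+ 2)).
  by rewrite /t; field; rewrite F1 gt_eqF.
apply: ler_wpM2l; lra.
Qed.

End ProductMeasure.

(** * One coordinate of the channel: subgaussian posterior means *)

Section BinarySymmetricChannel.
Variable R : realType.
Implicit Types (lam t u : R) (n : nat).

Definition sg (b : bool) : R := if b then 1 else -1.

Definition bsc1 (lam : R) (th b : bool) : R :=
  if b == th then 1 - (1 - lam) / 2 else (1 - lam) / 2.

Lemma bsc_pmfE d lam (th x : cube d) :
  bsc_pmf lam th x = prodm (fun i => bsc1 lam (th i)) x.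
Proof. by []. Qed.

Lemma bsc1E lam th b : bsc1 lam th b = (1 + lam * sg th * sg b) / 2.
Proof. by rewrite /bsc1; case: th; case: b; rewrite /sg /=; lra. Qed.

Lemma sgN b : sg (~~ b) = - sg b.
Proof. by case: b; rewrite /sg /= ?opprK. Qed.

Lemma sg_sqr b : sg b * sg b = 1.
Proof. by case: b; rewrite /sg /=; ring. Qed.

Lemma bsc1_ge0 lam th b : -1 <= lam -> lam <= 1 -> 0 <= bsc1 lam th b.
Proof. by move=> l0 l1; rewrite bsc1E; case: th; case: b; rewrite /sg /=; lra. Qed.

Lemma sum_bsc1 lam th : \sum_b bsc1 lam th b = 1.
Proof. by rewrite big_bool /= !bsc1E /sg; case: th; lra. Qed.

Lemma bsc1C lam th b : bsc1 lam th b = bsc1 lam b th.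
Proof. by rewrite !bsc1E mulrAC. Qed.

Lemma bsc1NN lam th b : bsc1 lam (~~ th) (~~ b) = bsc1 lam th b.
Proof. by rewrite !bsc1E !sgN; congr (_ / _); ring. Qed.

Lemma mix_half_bsc1 lam b : mix (half R) (bsc1 lam) b = half R b.
Proof. by rewrite /mix big_bool /= !bsc1E /half /sg; case: b; lra. Qed.

(** Given the output [b], the posterior mean of the input is [lam * sg b], a symmetric sign times
    [lam], so [cosh_le_expR] gives the variance proxy [2 * lam ^+ 2]. *)
Lemma sdpi_bsc1 lam : 0 < lam -> lam <= 1 -> sdpi (8 * lam ^+ 2) (half R) (bsc1 lam).
Proof.
move=> l0 l1.
have -> : 8 * lam ^+ 2 = 4 * (2 * lam ^+ 2) by ring.
apply: (@sdpi_bit _ _ _ _ (fun b => lam * sg b)).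
- by rewrite mulr_gt0 // exprn_gt0.
- by move=> b v; apply: bsc1_ge0; lra.
- exact: sum_bsc1.
- by move=> v; rewrite mix_half_bsc1 !bsc1E /half /sg; case: v; lra.
move=> t.
rewrite /expect big_bool /= !mix_half_bsc1 /half /sg mulr1 mulrN1.
have := cosh_le_expR (t * lam); rewrite mulrN.
have -> : 2 * (t * lam) ^+ 2 = 2 * lam ^+ 2 * t ^+ 2 by ring.
lra.
Qed.

(** The [n] observations of one coordinate. Given theta, the columns of a sample are independent. *)
Definition column n := {ffun 'I_n -> bool}.

Definition column_pmf n lam (b : bool) : column n -> R :=
  prodm (fun=> bsc1 lam b).

Definition column_sum n (v : column n) : R := \sum_j sg (v j).

Definition flip n (v : column n) : column n := [ffun j => ~~ v j].

Lemma flipK n : involutive (@flip n).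
Proof. by move=> v; apply/ffunP => j; rewrite !ffunE negbK. Qed.

Lemma sum_flip n (g : column n -> R) : \sum_v g v = \sum_v g (flip v).
Proof. exact/reindex_inj/inv_inj/flipK. Qed.

Lemma column_pmf_flip n lam b (v : column n) :
  column_pmf lam b (flip v) = column_pmf lam (~~ b) v.
Proof. by apply: eq_bigr => j _; rewrite ffunE -bsc1NN negbK. Qed.

Lemma column_sum_flip n (v : column n) : column_sum (flip v) = - column_sum v.
Proof. by rewrite /column_sum -sumrN; apply: eq_bigr => j _; rewrite ffunE sgN. Qed.

Lemma column_pmf_ge0 n lam b (v : column n) :
  -1 <= lam -> lam <= 1 -> 0 <= column_pmf lam b v.
Proof. by move=> l0 l1; apply: prodm_ge0 => *; apply: bsc1_ge0. Qed.

Lemma sum_column_pmf n lam b : \sum_(v : column n) column_pmf lam b v = 1.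
Proof. by apply: sum_prodm1 => _; apply: sum_bsc1. Qed.

Lemma mgf_column n lam b u :
  expect (@column_pmf n lam b) (fun v => expR (u * column_sum v)) =
  (bsc1 lam b true * expR u + bsc1 lam b false * expR (- u)) ^+ n.
Proof.
have -> : bsc1 lam b true * expR u + bsc1 lam b false * expR (- u) =
    \sum_s bsc1 lam b s * expR (u * sg s).
  by rewrite big_bool /= /sg mulr1 mulrN1.
rewrite -[n in RHS]card_ord -prodr_const bigA_distr_bigA.
apply: eq_bigr => v _; rewrite big_split /=; congr (_ * _).
by rewrite /column_sum mulr_sumr expR_sum.
Qed.

(** With tau = tanh u the left side is cosh u (1 + lam tau). The odd term [lam * tau] is kept in the
    exponent, so that the two values of the bit can later be recombined into a cosh. *)
Lemma mgf_factor_le lam u : 0 <= lam -> lam <= 1 ->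
  let tau := (expR (2 * u) - 1) / (expR (2 * u) + 1) in
  (1 + lam) / 2 * expR u + (1 - lam) / 2 * expR (- u) <=
  expR (2 * u ^+ 2 + lam * tau).
Proof.
move=> l0 l1 /=; set tau := (_ / (expR (2 * u) + 1)).
have e0 := expR_gt0 u; have f0 := expR_gt0 (- u).
have ef := expRxMexpNx_1 u.
have -> : (1 + lam) / 2 * expR u + (1 - lam) / 2 * expR (- u) =
   (expR u + expR (- u)) / 2 * (1 + lam * tau).
  rewrite /tau mulrC [2 * u]mulrC expRM_natr expRN; field.
  by repeat (apply/andP; split); apply: lt0r_neq0; rewrite // addr_gt0 // exprn_gt0.
rewrite expRD; apply: ler_pM => //.
- by apply: divr_ge0; lra.
- have g0 := expR_gt0 (2 * u).
  have -> : 1 + lam * tau =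
      ((1 - lam) + (1 + lam) * expR (2 * u)) / (expR (2 * u) + 1).
    by rewrite /tau; field; apply: lt0r_neq0; lra.
  apply: divr_ge0; last by lra.
  by apply: addr_ge0; [lra|apply: mulr_ge0; lra].
- have := cosh_le_expR u; lra.
exact: expR_ge1Dx.
Qed.

(** The two bit values contribute exponents 2 n u^2 + n lam tau and 2 n u^2 - n lam tau. Their sum
    is a cosh, bounded by a Gaussian in n lam tau; with n lam^2 <= 1 and |tau| <= 2 |u| this costs 8
    n u^2 more. *)
Lemma mgf_column_mix n lam u : 0 <= lam -> lam <= 1 -> n%:R * lam ^+ 2 <= 1 ->
  expect (mix (half R) (@column_pmf n lam))
    (fun v => expR (u * column_sum v) + expR (- (u * column_sum v))) <=
  2 * expR (10 * n%:R * u ^+ 2).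
Proof.
move=> l0 l1 nl.
rewrite expect_mix expect_half !expectD.
rewrite !(@eq_expect _ _ _ (fun v => expR (- (u * column_sum v)))
  (fun v => expR ((- u) * column_sum v)) (fun v => congr1 _ (esym (mulNr _ _)))).
rewrite !mgf_column !opprK !bsc1E /sg.
pose tau := (expR (2 * u) - 1) / (expR (2 * u) + 1).
have h1 : (1 + lam) / 2 * expR u + (1 - lam) / 2 * expR (- u) <=
    expR (2 * u ^+ 2 + lam * tau) by apply: mgf_factor_le.
have h2 : (1 + lam) / 2 * expR (- u) + (1 - lam) / 2 * expR u <=
    expR (2 * u ^+ 2 - lam * tau).
  have := @mgf_factor_le lam (- u) l0 l1; rewrite opprK sqrrN /=.
  set t' := ((expR (2 * - u) - 1) / _); have -> // : t' = - tau; last by rewrite mulrN.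
  rewrite /t' /tau mulrN expRN; field.
  have g0 := expR_gt0 (2 * u).
  by repeat (apply/andP; split); apply: lt0r_neq0; lra.
have u0 := expR_gt0 u; have v0 := expR_gt0 (- u).
have p1 : 0 <= (1 + lam) / 2 * expR u + (1 - lam) / 2 * expR (- u).
  by apply: addr_ge0; apply: mulr_ge0; lra.
have p2 : 0 <= (1 + lam) / 2 * expR (- u) + (1 - lam) / 2 * expR u.
  by apply: addr_ge0; apply: mulr_ge0; lra.
have q1 := @lerXn2r _ n _ _ p1 (expR_ge0 _) h1.
have q2 := @lerXn2r _ n _ _ p2 (expR_ge0 _) h2.
rewrite -expRM_natl mulrDr expRD in q1.
rewrite -expRM_natl mulrBr expRD in q2.
have q3 := cosh_le_expR (n%:R * (lam * tau)).
have q4 : 2 * (n%:R * (lam * tau)) ^+ 2 <= 8 * n%:R * u ^+ 2.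
  have t2 : tau ^+ 2 <= 4 * u ^+ 2.
    have := ler_tanh (2 * u); rewrite -/tau -ler_sqr ?nnegrE // !real_normK ?num_real //.
    by rewrite exprMn; lra.
  have -> : 2 * (n%:R * (lam * tau)) ^+ 2 = 2 * (n%:R * lam ^+ 2) * n%:R * tau ^+ 2 by ring.
  have -> : 8 * n%:R * u ^+ 2 = 2 * 1 * n%:R * (4 * u ^+ 2) by ring.
  apply: ler_pM => //; try by rewrite ?sqr_ge0 // !mulr_ge0 // sqr_ge0.
  by apply: ler_wpM2r => //; apply: ler_wpM2l.
rewrite -ler_expR in q4.
have -> : 10 * n%:R * u ^+ 2 = n%:R * (2 * u ^+ 2) + 8 * n%:R * u ^+ 2 by ring.
rewrite expRD.
have q5 : expR (n%:R * (lam * tau)) + expR (- (n%:R * (lam * tau))) <= 2 * expR (8 * n%:R * u ^+ 2) by lra.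
have := ler_wpM2l (expR_ge0 (n%:R * (2 * u ^+ 2))) q5.
(* The four powers coincide in pairs with the two factors bounded above, up to the form in which the
   signs were unfolded. *)
set x1 := (X in X ^+ n); set x2 := (X in _ + X ^+ n + _).
have -> : x1 = (1 + lam) / 2 * expR u + (1 - lam) / 2 * expR (- u) by rewrite /x1 /=; lra.
have -> : x2 = (1 + lam) / 2 * expR (- u) + (1 - lam) / 2 * expR u by rewrite /x2 /=; lra.
set x3 := (X in _ + (X ^+ n + _)); set x4 := (X in _ + (_ + X ^+ n)).
have -> : x3 = (1 + lam) / 2 * expR (- u) + (1 - lam) / 2 * expR u by rewrite /x3 /=; lra.
have -> : x4 = (1 + lam) / 2 * expR u + (1 - lam) / 2 * expR (- u) by rewrite /x4 /=; lra.
lra.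
Qed.

Definition log_odds (lam : R) : R := ln ((1 + lam) / (1 - lam)).

Lemma bsc1_true_false lam b : 0 <= lam -> lam < 1 ->
  bsc1 lam true b = bsc1 lam false b * expR (log_odds lam * sg b).
Proof.
move=> l0 l1; have q0 : 0 < (1 + lam) / (1 - lam) by apply: divr_gt0; lra.
have nz : 1 - lam != 0 by apply: lt0r_neq0; lra.
rewrite !bsc1E /log_odds /sg; case: b; first by rewrite !mulr1 lnK ?posrE //; field.
rewrite !mulr1 !mulrN1 expRN lnK ?posrE //.
by field; rewrite nz /=; apply: lt0r_neq0; lra.
Qed.

(** The likelihood ratio depends on the column through its sum alone. *)
Lemma column_pmf_true_false n lam (v : column n) : 0 <= lam -> lam < 1 ->
  column_pmf lam true v = column_pmf lam false v * expR (log_odds lam * column_sum v).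
Proof.
move=> l0 l1; rewrite /column_sum mulr_sumr expR_sum -big_split.
by apply: eq_bigr => j _; apply: bsc1_true_false.
Qed.

Lemma log_odds_bound lam : 0 <= lam -> lam <= 2^-1 -> 0 <= log_odds lam <= 3 * lam.
Proof.
move=> l0 l1; apply/andP; split.
  by apply: ln_ge0; rewrite ler_pdivlMr; lra.
rewrite /log_odds ln_div ?posrE; [|lra|lra].
have := @ln_le_subr1 _ (1 + lam) ltac:(lra).
have := @ln_le_subr1 _ (1 - lam)^-1; rewrite invr_gt0 lnV ?posrE; last by lra.
move=> /(_ ltac:(lra)).
suff : (1 - lam)^-1 - 1 <= 2 * lam by lra.
have -> : (1 - lam)^-1 - 1 = lam / (1 - lam) by field; apply: lt0r_neq0; lra.
rewrite ler_pdivrMr; last by lra.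
have : 0 <= lam * (1 - 2 * lam) by apply: mulr_ge0; lra.
lra.
Qed.

(** The posterior mean [m] is the tanh of half the log-likelihood ratio, so it is odd under [flip]
    and at most [3 * lam * |S|], with S the column sum. By symmetry its exponential moment is a mean
    of cosh, dominated by that of [3 * lam * t * S]; [mgf_column_mix] then gives 10 * 3^2 = 90, and
    [sdpi_bit] multiplies by 4. *)
Lemma sdpi_column n lam : (0 < n)%N -> 0 < lam -> lam <= 2^-1 ->
  n%:R * lam ^+ 2 <= 1 ->
  sdpi (360 * lam ^+ 2 * n%:R) (half R) (@column_pmf n lam).
Proof.
move=> n0 l0 l1 nl.
have -> : 360 * lam ^+ 2 * n%:R = 4 * (90 * lam ^+ 2 * n%:R) by ring.
pose m (v : column n) :=
  (expR (log_odds lam * column_sum v) - 1) / (expR (log_odds lam * column_sum v) + 1).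
set p := mix (half R) (@column_pmf n lam).
have pE v : p v = column_pmf lam false v * (expR (log_odds lam * column_sum v) + 1) / 2.
  rewrite /p /mix big_bool /= column_pmf_true_false /half; lra.
have mN v : m (flip v) = - m v.
  rewrite /m column_sum_flip mulrN expRN; field.
  have g0 := expR_gt0 (log_odds lam * column_sum v).
  by repeat (apply/andP; split); apply: lt0r_neq0; lra.
have pN v : p (flip v) = p v.
  by rewrite /p /mix !big_bool /= !column_pmf_flip /half addrC.
have p0 v : 0 <= p v.
  rewrite pE; apply: divr_ge0 => //; apply: mulr_ge0.
    by apply: column_pmf_ge0; lra.
  by apply: addr_ge0; rewrite ?expR_ge0.
apply: (@sdpi_bit _ _ _ _ m).
- by rewrite !mulr_gt0 ?exprn_gt0 ?ltr0n.
- by move=> b v; apply: column_pmf_ge0; lra.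
- exact: sum_column_pmf.
- move=> v; rewrite -/p pE /m column_pmf_true_false; [|lra|lra].
  have g0 := expR_gt0 (log_odds lam * column_sum v).
  by field; apply: lt0r_neq0; lra.
move=> t; rewrite -/p.
have E : expect p (fun v => expR (t * m v)) = expect p (fun v => expR (- (t * m v))).
  by rewrite /expect sum_flip; apply: eq_bigr => v _; rewrite pN mN mulrN.
suff : expect p (fun v => expR (t * m v)) + expect p (fun v => expR (- (t * m v))) <=
    2 * expR (90 * lam ^+ 2 * n%:R * t ^+ 2) by rewrite -E; lra.
have -> : 90 * lam ^+ 2 * n%:R * t ^+ 2 = 10 * n%:R * (3 * lam * t) ^+ 2 by ring.
apply: le_trans (@mgf_column_mix n lam (3 * lam * t) (ltW l0) _ nl); last by lra.
rewrite -expectD; apply: ler_expect => // v; apply: cosh_homo.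
have hm : `|m v| <= 3 * lam * `|column_sum v|.
  apply: (le_trans (ler_tanh _)); rewrite normrM; apply: ler_wpM2r => //.
  by have /andP[h1 h2] := log_odds_bound (ltW l0) l1; rewrite ger0_norm.
rewrite normrM; have -> : `|3 * lam * t * column_sum v| = `|t| * (3 * lam * `|column_sum v|).
  by rewrite !normrM (ger0_norm (ltW l0)) ger0_norm //; ring.
exact: ler_wpM2l.
Qed.

End BinarySymmetricChannel.

(** * Memorization as conditional mutual information *)

Section Memorization.
Variable R : realType.
Implicit Types (lam t : R) (d n : nat).

(** Lists the sample by coordinates instead of observations, so that its law given theta is a
    product over the bits of theta, as tensorization requires. *)
Definition transpose d n (Y : {ffun 'I_d -> column n}) : sample d n :=
  [ffun j => [ffun i => Y i j]].

Lemma transpose_bij d n : bijective (@transpose d n).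
Proof.
exists (fun X : sample d n => [ffun i => [ffun j => X j i]]) => X;
  by do 2![apply/ffunP => ?; rewrite !ffunE].
Qed.

Lemma ent_reindex (V W : finType) (u : W -> V) (p f : V -> R) : bijective u ->
  ent p f = ent (fun w => p (u w)) (fun w => f (u w)).
Proof.
move=> bu; have E g : expect p g = expect (fun w => p (u w)) (fun w => g (u w)).
  by rewrite /expect (reindex u) //; apply: onW_bij.
by rewrite /ent !E.
Qed.

Definition sample_pmf d n lam (th : cube d) : sample d n -> R :=
  iid_pmf (bsc_pmf lam th).

Lemma sample_pmf_transpose d n lam (th : cube d) (Y : {ffun 'I_d -> column n}) :
  sample_pmf lam th (transpose Y) = prodm (fun i => column_pmf lam (th i)) Y.
Proof.
rewrite /sample_pmf /iid_pmf /prodm /column_pmf /prodm exchange_big.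
by apply: eq_bigr => j _; apply: eq_bigr => i _; rewrite !ffunE.
Qed.

Lemma expect_sample_pmf d n lam (th : cube d) (f : sample d n -> R) :
  expect (sample_pmf lam th) f =
  expect (prodm (fun i => column_pmf lam (th i))) (fun Y => f (transpose Y)).
Proof.
rewrite /expect (reindex (@transpose d n)); last exact/onW_bij/transpose_bij.
by apply: eq_bigr => Y _; rewrite sample_pmf_transpose.
Qed.

Lemma unif_pmfE d (x : cube d) : unif_pmf R x = prodm (fun=> half R) x.
Proof. by rewrite /unif_pmf /prodm prodr_const card_ord /half exprVn. Qed.

Lemma unif_pmf_ge0 d (x : cube d) : 0 <= unif_pmf R x.
Proof. by rewrite invr_ge0 exprn_ge0. Qed.

Lemma sum_unif_pmf d : \sum_(x : cube d) unif_pmf R x = 1.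
Proof.
rewrite (eq_bigr _ (fun x _ => unif_pmfE x)).
by apply: sum_prodm1 => _; apply: sum_half.
Qed.

Lemma bsc_pmf_ge0 d lam (th x : cube d) :
  -1 <= lam -> lam <= 1 -> 0 <= bsc_pmf lam th x.
Proof. by move=> l0 l1; rewrite bsc_pmfE; apply: prodm_ge0 => *; apply: bsc1_ge0. Qed.

Lemma sum_bsc_pmf d lam (th : cube d) : \sum_x bsc_pmf lam th x = 1.
Proof.
by apply: (@sum_prodm1 _ _ _ (fun i => bsc1 lam (th i))) => i; apply: sum_bsc1.
Qed.

Lemma bsc_pmfC d lam (th x : cube d) : bsc_pmf lam th x = bsc_pmf lam x th.
Proof. by apply: eq_bigr => i _; apply: bsc1C. Qed.

Lemma mix_unif_bsc d lam (x : cube d) :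
  mix (@unif_pmf R d) (bsc_pmf lam) x = unif_pmf R x.
Proof.
transitivity (mix (prodm (fun _ : 'I_d => half R))
    (fun w : {ffun 'I_d -> bool} => prodm (fun i => bsc1 lam (w i))) x).
  by apply: eq_bigr => th _; rewrite unif_pmfE.
rewrite (mix_prodm (fun=> half R) (fun=> bsc1 lam)) unif_pmfE.
by apply: eq_bigr => i _; exact: mix_half_bsc1.
Qed.

Lemma sample_pmf_ge0 d n lam (th : cube d) (X : sample d n) :
  -1 <= lam -> lam <= 1 -> 0 <= sample_pmf lam th X.
Proof. by move=> l0 l1; apply: prodr_ge0 => *; apply: bsc_pmf_ge0. Qed.

Lemma sum_sample_pmf d n lam (th : cube d) :
  \sum_(X : sample d n) sample_pmf lam th X = 1.
Proof.
by apply: (@sum_prodm1 _ _ _ (fun _ : 'I_n => bsc_pmf lam th)) => j; apply: sum_bsc_pmf.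
Qed.

Lemma sdpi_cube d lam : 0 < lam -> lam <= 1 ->
  sdpi (8 * lam ^+ 2) (@unif_pmf R d) (bsc_pmf lam).
Proof.
move=> l0 l1 f f0.
have r0 : 0 <= 8 * lam ^+ 2 by rewrite mulr_ge0 ?sqr_ge0.
have h0 b : 0 <= half R b by rewrite invr_ge0.
have K0 b v : 0 <= bsc1 lam b v by apply: bsc1_ge0; lra.
have := @sdpi_prodm R d bool bool _ (half R) (bsc1 lam) r0 h0 (sum_half R) K0
  (sum_bsc1 lam) (sdpi_bsc1 l0 l1) f f0.
rewrite (eq_ent (fun x => esym (unif_pmfE x)) (fun=> erefl)) => h.
apply: (le_trans h).
rewrite le_eqVlt; apply/orP; left; apply/eqP; congr (_ * _); apply: eq_ent => // x.
by apply: eq_bigr => w _; rewrite unif_pmfE.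
Qed.

Lemma sdpi_sample d n lam : (0 < n)%N -> 0 < lam -> lam <= 2^-1 ->
  n%:R * lam ^+ 2 <= 1 ->
  sdpi (360 * lam ^+ 2 * n%:R) (@unif_pmf R d) (@sample_pmf d n lam).
Proof.
move=> n0 l0 l1 nl f f0.
have r0 : 0 <= 360 * lam ^+ 2 * n%:R.
  by apply: mulr_ge0 => //; apply: mulr_ge0 => //; apply: sqr_ge0.
have h0 b : 0 <= half R b by rewrite invr_ge0.
have K0 b (v : column n) : 0 <= column_pmf lam b v by apply: column_pmf_ge0; lra.
have := @sdpi_prodm R d bool (column n) _ (half R) (@column_pmf R n lam) r0 h0 (sum_half R)
  K0 (@sum_column_pmf R n lam) (sdpi_column n0 l0 l1 nl) (fun Y => f (transpose Y))
  (fun Y => f0 (transpose Y)).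
move=> h; apply: le_trans (le_trans h _).
  rewrite le_eqVlt; apply/orP; left; apply/eqP; apply: eq_ent => th.
    exact: unif_pmfE.
  exact: expect_sample_pmf.
rewrite [in leRHS](ent_reindex _ _ (@transpose_bij d n)).
rewrite le_eqVlt; apply/orP; left; apply/eqP; congr (_ * _); apply: eq_ent => // Y.
by apply: eq_bigr => th _; rewrite unif_pmfE sample_pmf_transpose.
Qed.

(** Mutual information is at most the output entropy, since [f * ln f <= 0] for a kernel with values
    in [0, 1], and the output entropy is at most the cross entropy with any subprobability [Q]. *)
Lemma sum_ent_le (H V : finType) (p : V -> R) (f : H -> V -> R) (Q : H -> R) :
  (forall v, 0 <= p v) -> (forall h v, 0 <= f h v <= 1) ->
  \sum_h expect p (f h) = 1 -> (forall h, 0 <= Q h) -> \sum_h Q h <= 1 ->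
  (forall h, Q h = 0 -> expect p (f h) = 0) ->
  \sum_h ent p (f h) <= - \sum_h expect p (f h) * ln (Q h).
Proof.
move=> p0 f01 F1 Q0 Q1 Qf.
have f0 h v : 0 <= f h v by have /andP[] := f01 h v.
have := @gibbs R H (fun=> 1) (fun h => expect p (f h)) Q (fun=> ler01)
  (fun h => expect_ge0 p0 (f0 h)) Q0 Qf.
have e1 (g : H -> R) : expect (fun=> 1) g = \sum_h g h.
  by apply: eq_bigr => h _; rewrite mul1r.
rewrite /ent !e1 F1 ln1 mulr0 subr0 mul1r.
have lQ := ln_le0 Q1.
move=> h; apply: (@le_trans _ _ (- \sum_h expect p (f h) * ln (expect p (f h)))); last by lra.
rewrite -sumrN; apply: ler_sum => h' _; rewrite -[leRHS]add0r lerD2r.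
rewrite /expect; apply: sumr_le0 => v _; apply: mulr_ge0_le0 => //.
have /andP[g0 g1] := f01 h' v.
by apply: mulr_ge0_le0 => //; apply: ln_le0.
Qed.

Section Algorithm.
Variables (d n : nat) (lam : R) (A : sample d n -> classifier d -> R).
Hypotheses (lam0 : 0 < lam) (lam1 : lam <= 1) (algoA : is_algo A).

Let lamN1 : -1 <= lam. Proof. by move: lam0; lra. Qed.

Lemma algo_ge0 X h : 0 <= A X h. Proof. by have [] := algoA X. Qed.

Lemma algo_le1 X h : A X h <= 1.
Proof.
have [A0 <-] := algoA X; rewrite (bigD1 h) //= lerDl.
by apply: sumr_ge0.
Qed.

Lemma out_margE th h : out_marg lam A th h = expect (sample_pmf lam th) (A^~ h).
Proof. by []. Qed.

Lemma out_marg_ge0 th h : 0 <= out_marg lam A th h.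
Proof. by apply: expect_ge0 => X; [exact: sample_pmf_ge0|exact: algo_ge0]. Qed.

Lemma out_marg_le1 th h : out_marg lam A th h <= 1.
Proof.
rewrite -(expect_cst 1 (sum_sample_pmf n lam th)).
by apply: ler_expect => X; [exact: sample_pmf_ge0|exact: algo_le1].
Qed.

Lemma sum_out_marg th : \sum_h out_marg lam A th h = 1.
Proof.
rewrite -[LHS](expect_sum (sample_pmf lam th) predT (fun h => A^~ h)).
rewrite -[RHS](expect_cst 1 (sum_sample_pmf n lam th)).
by apply: eq_expect => X; have [] := algoA X.
Qed.

Lemma mi_givenE th : mi_given lam A th = \sum_h ent (sample_pmf lam th) (A^~ h).
Proof.
rewrite /mi_given exchange_big; apply: eq_bigr => h _.
rewrite /ent -out_margE {2}out_margE /expect mulr_suml -sumrB.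
apply: eq_bigr => X _; rewrite -[iid_pmf _ X]/(sample_pmf lam th X).
have [->|An] := eqVneq (A X h) 0; first by rewrite !(mulr0, mul0r) subrr.
have [->|pn] := eqVneq (sample_pmf lam th X) 0; first by rewrite !mul0r subrr.
have A0 : 0 < A X h by rewrite lt_neqAle eq_sym An algo_ge0.
have p0 : 0 < sample_pmf lam th X.
  by rewrite lt_neqAle eq_sym pn sample_pmf_ge0.
have g0 : 0 < out_marg lam A th h.
  apply: (@lt_le_trans _ _ (sample_pmf lam th X * A X h)); first exact: mulr_gt0.
  rewrite out_margE /expect (bigD1 X) //= lerDl; apply: sumr_ge0 => Y _.
  by rewrite mulr_ge0 ?sample_pmf_ge0 ?algo_ge0.
by rewrite ln_div ?posrE //; ring.
Qed.

Lemma mi_given_ge0 th : 0 <= mi_given lam A th.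
Proof.
rewrite mi_givenE; apply: sumr_ge0 => h _; apply: ent_ge0 => [X||X].
- exact: sample_pmf_ge0.
- exact: sum_sample_pmf.
exact: algo_ge0.
Qed.

Lemma memo_ge0 : 0 <= memo lam A.
Proof.
apply: sumr_ge0 => th _; apply: mulr_ge0; first exact: unif_pmf_ge0.
exact: mi_given_ge0.
Qed.

Lemma memo_le b : (forall th, mi_given lam A th <= b) -> memo lam A <= b.
Proof.
move=> hb; rewrite -[leRHS](expect_cst b (sum_unif_pmf d)).
by apply: ler_expect => // th; exact: unif_pmf_ge0.
Qed.

Lemma mi_given_le th (Q : classifier d -> R) :
  (forall h, 0 <= Q h) -> \sum_h Q h <= 1 ->
  (forall h, Q h = 0 -> out_marg lam A th h = 0) ->
  mi_given lam A th <= - \sum_h out_marg lam A th h * ln (Q h).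
Proof.
move=> Q0 Q1 Qg; rewrite mi_givenE; apply: sum_ent_le => // [X|h X|].
- exact: sample_pmf_ge0.
- by rewrite algo_ge0 algo_le1.
exact: sum_out_marg.
Qed.

(** I(A; theta), in nats. *)
Definition param_info : R := \sum_h ent (@unif_pmf R d) (fun th => out_marg lam A th h).

(** Probability of the output [h] given that a fresh test point equals [x]: for a uniform parameter
    and a symmetric channel, the posterior of theta given [x] is [bsc_pmf lam x]. *)
Definition test_density h x : R := expect (bsc_pmf lam x) (fun th => out_marg lam A th h).

Definition test_info : R := \sum_h ent (@unif_pmf R d) (test_density h).

(** The right side is I(A; X) for the unconditional sample law. Contraction is available for this
    quantity, not directly for the conditional [memo]. *)
Lemma memo_param_info :
  memo lam A + param_info =
  \sum_h ent (mix (@unif_pmf R d) (sample_pmf lam)) (A^~ h).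
Proof.
under [RHS]eq_bigr do rewrite ent_mix.
rewrite big_split /=; congr (_ + _).
rewrite -expect_sum; apply: eq_expect => th; exact: mi_givenE.
Qed.

Lemma param_info_le_memo : (0 < n)%N -> lam <= 2^-1 -> n%:R * lam ^+ 2 <= 1 ->
  param_info <= 360 * lam ^+ 2 * n%:R * (memo lam A + param_info).
Proof.
move=> n0 l2 nl; rewrite memo_param_info mulr_sumr; apply: ler_sum => h _.
by apply: sdpi_sample => // X; exact: algo_ge0.
Qed.

Lemma test_info_le_param : test_info <= 8 * lam ^+ 2 * param_info.
Proof.
rewrite mulr_sumr; apply: ler_sum => h _.
have := sdpi_cube lam0 lam1 (fun th => out_marg_ge0 th h).
by rewrite (eq_ent (@mix_unif_bsc d lam) (fun=> erefl)).
Qed.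

Lemma expect_out_marg1 : \sum_h expect (@unif_pmf R d) (fun th => out_marg lam A th h) = 1.
Proof.
rewrite -expect_sum -[RHS](expect_cst 1 (sum_unif_pmf d)).
by apply: eq_expect => th; exact: sum_out_marg.
Qed.

Lemma expect_test_density h :
  expect (@unif_pmf R d) (test_density h) =
  expect (@unif_pmf R d) (fun th => out_marg lam A th h).
Proof.
rewrite /test_density -expect_mix; apply: eq_bigr => x _.
by rewrite mix_unif_bsc.
Qed.

(** Each parameter has mass 2^-d, so a conditional output probability exceeds its average by at most
    the factor 2^d. *)
Lemma param_info_le_dim : param_info <= d%:R * ln 2.
Proof.
have -> : d%:R * ln 2 =
    \sum_h expect (@unif_pmf R d) (fun th => out_marg lam A th h) * (d%:R * ln 2).
  by rewrite -mulr_suml expect_out_marg1 mul1r.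
apply: ler_sum => h _.
set G := expect _ _; pose g th := out_marg lam A th h.
have g0 th : 0 <= g th by apply: out_marg_ge0.
rewrite /ent lerBlDr -/G.
have -> : G * (d%:R * ln 2) + G * ln G =
    expect (@unif_pmf R d) (fun th => (d%:R * ln 2 + ln G) * g th).
  by rewrite expectZ -/G; ring.
apply: ler_expect => [|th]; first exact: unif_pmf_ge0.
rewrite -/(g th); have [->|gn] := eqVneq (g th) 0; first by rewrite !(mul0r, mulr0).
have g1 : 0 < g th by rewrite lt_neqAle eq_sym gn g0.
rewrite mulrC; apply: ler_wpM2r => //.
have gG : (2 ^+ d)^-1 * g th <= G.
  rewrite /G /expect (bigD1 th) //= lerDl; apply: sumr_ge0 => u _.
  by apply: mulr_ge0; [exact: unif_pmf_ge0|exact: g0].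
have G0 : 0 < G by apply: lt_le_trans gG; rewrite mulr_gt0 // invr_gt0 exprn_gt0.
have -> : d%:R * ln 2 = ln (2 ^+ d) :> R by rewrite lnXn // mulr_natl.
rewrite -lnM ?posrE ?exprn_gt0 // ler_ln ?posrE ?mulr_gt0 ?exprn_gt0 //.
by rewrite -ler_pdivrMl ?exprn_gt0.
Qed.

Lemma test_density_bounds h x : 0 <= test_density h x <= 1.
Proof.
apply/andP; split.
  by apply: expect_ge0 => th; [exact: bsc_pmf_ge0|exact: out_marg_ge0].
rewrite -(expect_cst 1 (sum_bsc_pmf lam x)).
by apply: ler_expect => th; [exact: bsc_pmf_ge0|exact: out_marg_le1].
Qed.

(** Cross entropy with the uniform law on [M]. Combined with the lower bound on [test_info], it
    keeps the argument of the logarithm in the theorem large. *)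
Lemma test_info_le_ln_card (M : {set classifier d}) :
  outputs_in A M -> test_info <= ln #|M|%:R.
Proof.
move=> AM.
have g0 th h : h \notin M -> out_marg lam A th h = 0.
  by move=> hM; apply: big1 => X _; rewrite AM ?mulr0.
have k0 h : h \notin M -> expect (@unif_pmf R d) (test_density h) = 0.
  move=> hM; rewrite expect_test_density; apply: big1 => th _.
  by rewrite g0 ?mulr0.
have K1 : \sum_h expect (@unif_pmf R d) (test_density h) = 1.
  by under eq_bigr do rewrite expect_test_density; exact: expect_out_marg1.
have M0 : (0 < #|M|)%N.
  rewrite lt0n; apply/negP => /eqP/cards0_eq M0; move/eqP: K1.
  rewrite big1 ?(eq_sym 0) ?oner_eq0 // => h _.
  by rewrite k0 // M0 inE.
apply: (@le_trans _ _ (- \sum_h expect (@unif_pmf R d) (test_density h) *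
   ln (if h \in M then #|M|%:R^-1 else 0))).
  apply: sum_ent_le => //.
  - by move=> v; exact: unif_pmf_ge0.
  - exact: test_density_bounds.
  - by move=> h; case: ifP => // _; rewrite invr_ge0.
  - rewrite -big_mkcond /= sumr_const -[leLHS]mulr_natl divff // pnatr_eq0 -lt0n //.
  move=> h; case: ifPn => [_ /eqP|/k0 //].
  by rewrite invr_eq0 pnatr_eq0 -leqn0 leqNgt M0.
have -> : ln #|M|%:R = \sum_h expect (@unif_pmf R d) (test_density h) * ln #|M|%:R :> R.
  by rewrite -mulr_suml K1 mul1r.
rewrite -sumrN; apply: ler_sum => h _.
case: ifPn => [_|/k0 ->]; last by rewrite !mul0r oppr0.
by rewrite lnV ?posrE ?ltr0n // mulrN opprK.
Qed.

(** The two sums are the probabilities that the classifier accepts under the joint law of output and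
    test point, and under the product of their marginals: the algorithm becomes a test between these
    two laws. *)
Lemma err_alg_test :
  err_alg lam A =
  (1 - \sum_h expect (@unif_pmf R d) (fun x => test_density h x * (h x)%:R)
     + \sum_h expect (@unif_pmf R d) (test_density h) *
              expect (@unif_pmf R d) (fun x => (h x)%:R)) / 2.
Proof.
have errE th h : err_h lam th h = 2^-1 * (1 - expect (bsc_pmf lam th) (fun x => (h x)%:R)
    + expect (@unif_pmf R d) (fun x => (h x)%:R)).
  rewrite /err_h -mulrDr; congr (_ * (_ + _)).
  rewrite -[X in X - _](expect_cst 1 (sum_bsc_pmf lam th)) -expectB.
  by apply: eq_expect => x; case: (h x); rewrite /= ?subrr ?subr0.
have -> : err_alg lam A = expect (@unif_pmf R d) (fun th =>
    \sum_h err_h lam th h * out_marg lam A th h).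
  apply: eq_expect => th.
  under [RHS]eq_bigr do rewrite -expectZ.
  rewrite -expect_sum; apply: eq_expect => X.
  by apply: eq_bigr => h _; rewrite mulrC.
rewrite expect_sum -[X in (X - _ + _) / _]expect_out_marg1 -sumrB -big_split mulr_suml.
apply: eq_bigr => h _ /=.
set b := expect _ (fun x : cube d => (h x)%:R).
rewrite expect_test_density.
have -> : expect (@unif_pmf R d) (fun x => test_density h x * (h x)%:R) =
   expect (@unif_pmf R d) (fun th => out_marg lam A th h * expect (bsc_pmf lam th) (fun x => (h x)%:R)).
  rewrite /test_density /expect /unif_pmf -!mulr_sumr; congr (_ * _).
  under eq_bigr do rewrite mulr_suml.
  rewrite exchange_big; apply: eq_bigr => th _ /=; rewrite mulr_sumr.
  by apply: eq_bigr => x _; rewrite (bsc_pmfC lam x th) mulrCA mulrA.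
rewrite (@eq_expect _ _ _ _ (fun th => 2^-1 * (out_marg lam A th h
   - out_marg lam A th h * expect (bsc_pmf lam th) (fun x => (h x)%:R)
   + b * out_marg lam A th h))); last first.
  by move=> th; rewrite errE -/b; ring.
by rewrite expectZ expectD expectB expectZ mulrC; congr (_ * _); ring.
Qed.

(** Donsker-Varadhan with the test function [t * h x]. Replacing ln (1 + y) by y keeps the bound
    linear, so that it sums over the outputs. *)
Lemma test_info_ge t :
  t * (\sum_h expect (@unif_pmf R d) (fun x => test_density h x * (h x)%:R))
  - (\sum_h expect (@unif_pmf R d) (test_density h) *
              expect (@unif_pmf R d) (fun x => (h x)%:R)) * (expR t - 1)
  <= test_info.
Proof.
rewrite mulr_sumr mulr_suml -sumrB; apply: ler_sum => h _.
have k0 x : 0 <= test_density h x by have /andP[] := test_density_bounds h x.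
have := donsker_varadhan (fun x => t * (h x)%:R) (@unif_pmf_ge0 d) k0.
rewrite (@eq_expect _ _ _ (fun v => test_density h v * (t * (h v)%:R))
   (fun v => t * (test_density h v * (h v)%:R))); last by move=> x; rewrite mulrCA.
rewrite expectZ => dv; rewrite lerBlDr (le_trans dv) // lerD2l -mulrA.
apply: ler_wpM2l; first by apply: expect_ge0 => //; exact: unif_pmf_ge0.
set b := expect _ (fun x => (h x)%:R).
have -> : expect (@unif_pmf R d) (fun v => expR (t * (h v)%:R)) = 1 + b * (expR t - 1).
  transitivity (expect (@unif_pmf R d) (fun x => 1 + (expR t - 1) * (h x)%:R)).
    apply: eq_expect => x; case: (h x); rewrite /= ?mulr1 ?mulr0 ?expR0 ?addr0 //.
    by rewrite subrKC.
  by rewrite expectD expectZ (expect_cst 1 (sum_unif_pmf d)) mulrC.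
apply: le_ln1Dx.
have b0 : 0 <= b by apply: expect_ge0 => // x; exact: unif_pmf_ge0.
have b1 : b <= 1.
  rewrite -[leRHS](expect_cst 1 (sum_unif_pmf d)); apply: ler_expect => x.
    exact: unif_pmf_ge0.
  by case: (h x).
have := expR_gt0 t; move: b b0 b1 => b b0 b1 e0.
(* What remains is [-1 < b * (expR t - 1)], required by [le_ln1Dx]. *)
have [->|bn] := eqVneq b 1; first by lra.
have : b < 1 by rewrite lt_neqAle bn.
have : 0 <= b * expR t by apply: mulr_ge0 => //; apply: ltW.
lra.
Qed.

End Algorithm.
End Memorization.

(** * From small error to the memorization lower bound *)

Section LowerBound.
Variable R : realType.
Implicit Types (C alpha : R) (d n : nat).

(** The two regimes of [info_ge_C_alpha] meet at alpha = e^-4 / 2. Above it the log-odds of alpha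
    are at most 2 e^4 (1 - 2 alpha), and e^-4 / 16 turns this into the available (1 - 2 alpha)^2 /
    8. *)
Definition info_const : R := expR (- 4) / 16.

Lemma info_const_gt0 : 0 < info_const.
Proof. by rewrite divr_gt0 ?expR_gt0. Qed.

Lemma C_alpha_gt0 alpha : 0 < alpha -> alpha < 2^-1 -> 0 < C_alpha alpha.
Proof.
move=> a0 a1; apply: mulr_gt0; first by lra.
by apply: ln_gt0; rewrite ltr_pdivlMr //; lra.
Qed.

(* With [a - b >= 1 - 2 alpha], choose [t = -ln (2 alpha)] for tiny [alpha] and
   [t = (1 - 2 alpha) / 4] otherwise. *)
Lemma info_ge_C_alpha (a b alpha I : R) :
  0 < alpha -> alpha < 2^-1 -> 0 <= b -> a <= 1 -> (1 - a + b) / 2 <= alpha ->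
  (forall t, t * a - b * (expR t - 1) <= I) ->
  info_const * C_alpha alpha <= I.
Proof.
move=> al0 al1 b0 a1 ab hI; rewrite /info_const /C_alpha.
have e4 := expR_gt0 (- 4 : R).
have e4' : expR (- 4) <= 5^-1 :> R.
  rewrite expRN lef_pV2 ?posrE ?expR_gt0 //.
  by have := expR_ge1Dx (4 : R); lra.
have b2 : b <= 2 * alpha by lra.
have [small|large] := lerP alpha (expR (- 4) / 2).
  pose t := - ln (2 * alpha).
  have et : expR t = (2 * alpha)^-1 by rewrite expRN lnK // posrE; lra.
  have t4 : 4 <= t.
    rewrite lerNr -[leRHS]expRK ler_ln ?posrE ?expR_gt0 //; lra.
  have ln2a : ln (2 * alpha) = ln 2 + ln alpha by rewrite lnM ?posrE.
  have l2 : ln 2 <= 1 :> R by have := @ln_le_subr1 R 2 ltac:(lra); lra.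
  have hl : ln ((1 - alpha) / alpha) <= t + 1.
    rewrite ln_div ?posrE //; last by lra.
    have : ln (1 - alpha) <= 0 by apply: ln_le0; lra.
    rewrite /t; lra.
  have hl0 : 0 <= ln ((1 - alpha) / alpha).
    by apply: ln_ge0; rewrite ler_pdivlMr //; lra.
  have h1 : (1 - 2 * alpha) * ln ((1 - alpha) / alpha) <= t + 1.
    apply: (@le_trans _ _ (1 * ln ((1 - alpha) / alpha))); last by lra.
    by apply: ler_wpM2r => //; lra.
  have h2 : expR (- 4) / 16 * ((1 - 2 * alpha) * ln ((1 - alpha) / alpha)) <= 80^-1 * (t + 1).
    apply: ler_pM => //; [by lra| |by lra].
    by apply: mulr_ge0 => //; lra.
  apply: (le_trans h2); apply: le_trans (hI t).
  (* Here [b <= 2 * alpha] while [expR t] is the inverse of [2 * alpha]. *)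
  have : b * (expR t - 1) <= 1.
    have : b * expR t <= 1 by rewrite et ler_pdivrMr; lra.
    lra.
  have : (3 / 4) * t <= t * a by rewrite mulrC; apply: ler_wpM2l; lra.
  lra.
set de := 1 - 2 * alpha; pose t := de / 4.
have de0 : 0 < de by rewrite /de; lra.
have de1 : de <= 1 by rewrite /de; lra.
have et : expR t - 1 <= t + 2 * t ^+ 2.
  have := @expR_mul_le R t ltac:(rewrite /t; lra).
  have t0 : 0 < 1 - t by rewrite /t; lra.
  rewrite -ler_pdivlMr // => h.
  suff : 1 / (1 - t) <= 1 + t + 2 * t ^+ 2 by lra.
  rewrite ler_pdivrMr //.
  have : 0 <= t ^+ 2 * (1 - 2 * t) by apply: mulr_ge0; rewrite ?sqr_ge0 // /t; lra.
  have : (1 + t + 2 * t ^+ 2) * (1 - t) = 1 + t ^+ 2 * (1 - 2 * t) by ring.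
  lra.
have hl : ln ((1 - alpha) / alpha) <= 2 * de / expR (- 4).
  apply: (@le_trans _ _ (de / alpha)).
    have -> : de / alpha = (1 - alpha) / alpha - 1 by rewrite /de; field; apply: lt0r_neq0.
    by apply: ln_le_subr1; apply: divr_gt0; lra.
  rewrite [2 * de]mulrC -mulrA; apply: ler_wpM2l; first exact: ltW.
  rewrite -[leRHS]invrK lef_pV2 ?posrE ?invr_gt0 ?mulr_gt0 ?invr_gt0 //.
  by rewrite invfM invrK; lra.
have h1 : expR (- 4) / 16 * (de * ln ((1 - alpha) / alpha)) <= de ^+ 2 / 8.
  have := ler_wpM2l (ltW de0) hl => /(ler_wpM2l (ltW e4)).
  have -> : expR (- 4) * (de * (2 * de / expR (- 4))) = 2 * de ^+ 2.
    by field; apply: lt0r_neq0.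
  lra.
apply: (le_trans h1); apply: le_trans (hI t).
(* The gain [t * (a - b)] is at least de^2 / 4, and the quadratic term costs at most 2 t^2 = de^2 /
   8. *)
have : b * (expR t - 1) <= b * (t + 2 * t ^+ 2) by apply: ler_wpM2l.
have : b * (2 * t ^+ 2) <= 1 * (2 * t ^+ 2).
  apply: ler_wpM2r; last by lra.
  by apply: mulr_ge0 => //; apply: sqr_ge0.
have : t * de <= t * (a - b) by apply: ler_wpM2l; rewrite /de /t; lra.
have -> : t * de = de ^+ 2 / 4 by rewrite /t; field.
have -> : 1 * (2 * t ^+ 2) = de ^+ 2 / 8 by rewrite /t; field.
lra.
Qed.

Section Algorithm.
Variables (d n : nat) (lam : R) (A : sample d n -> classifier d -> R) (alpha : R).
Hypotheses (lam0 : 0 < lam) (lam1 : lam <= 1) (algoA : is_algo A).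
Hypotheses (alpha0 : 0 < alpha) (alpha1 : alpha < 2^-1).
Hypothesis errA : err_alg lam A <= alpha.

Lemma C_alpha_le_test_info : info_const * C_alpha alpha <= test_info lam A.
Proof.
move: errA; rewrite (err_alg_test lam algoA) => e.
apply: info_ge_C_alpha e _ => //.
- apply: sumr_ge0 => h _; apply: mulr_ge0; apply: expect_ge0 => x //.
  + exact: unif_pmf_ge0.
  + by have /andP[] := test_density_bounds lam0 lam1 algoA h x.
  + exact: unif_pmf_ge0.
- rewrite -[leRHS](expect_out_marg1 lam algoA); apply: ler_sum => h _.
  rewrite -expect_test_density; apply: ler_expect => x; first exact: unif_pmf_ge0.
  have /andP[k0 _] := test_density_bounds lam0 lam1 algoA h x.
  by case: (h x); rewrite ?mulr1 ?mulr0.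
by move=> t; exact: test_info_ge.
Qed.

Lemma C_alpha_le_param_info :
  info_const * C_alpha alpha <= 8 * lam ^+ 2 * param_info lam A.
Proof. exact: le_trans C_alpha_le_test_info (test_info_le_param lam0 lam1 algoA). Qed.

Lemma C_alpha_le_dim : info_const * C_alpha alpha <= 8 * lam ^+ 2 * d%:R.
Proof.
apply: (le_trans C_alpha_le_param_info).
apply: ler_wpM2l; first by apply: mulr_ge0 => //; apply: sqr_ge0.
apply: (le_trans (param_info_le_dim lam0 lam1 algoA)).
rewrite -[leRHS]mulr1; apply: ler_wpM2l => //.
by have := @ln_le_subr1 R 2 ltac:(lra); lra.
Qed.

Lemma C_alpha_le_ln_card (M : {set classifier d}) : outputs_in A M ->
  info_const * C_alpha alpha <= ln #|M|%:R.
Proof.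
by move=> AM; apply: (le_trans C_alpha_le_test_info); apply: test_info_le_ln_card.
Qed.

(** Contraction reads I(A; theta) <= rho (memo + I(A; theta)); moving I(A; theta) to the left
    produces the factor 1 - rho. The constant 2880 is 8 * 360. *)
Lemma memo_ge_C_alpha : (0 < n)%N -> lam <= 2^-1 -> 360 * lam ^+ 2 * n%:R <= 1 ->
  (1 - 360 * lam ^+ 2 * n%:R) * (info_const * C_alpha alpha) <=
  2880 * lam ^+ 4 * n%:R * memo lam A.
Proof.
move=> n0 l2 nl; set rho := 360 * _ * _ in nl *.
have nl1 : n%:R * lam ^+ 2 <= 1.
  have : 0 <= n%:R * lam ^+ 2 by apply: mulr_ge0 => //; apply: sqr_ge0.
  move: nl; rewrite /rho; lra.
have := param_info_le_memo lam0 lam1 algoA n0 l2 nl1; rewrite -/rho => h.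
have r1 : 0 <= 1 - rho by lra.
have := ler_wpM2l r1 C_alpha_le_param_info.
have l20 : 0 <= 8 * lam ^+ 2 by apply: mulr_ge0 => //; apply: sqr_ge0.
have : (1 - rho) * param_info lam A <= rho * memo lam A by lra.
move=> /(ler_wpM2l l20).
have -> : 2880 * lam ^+ 4 * n%:R * memo lam A = 8 * lam ^+ 2 * (rho * memo lam A).
  by rewrite /rho; ring.
have -> : 8 * lam ^+ 2 * ((1 - rho) * param_info lam A) =
  (1 - rho) * (8 * lam ^+ 2 * param_info lam A) by ring.
lra.
Qed.

End Algorithm.

Lemma lam_of_gt0 C d : 0 < C -> C ^+ 4 <= d%:R -> 0 < lam_of C d.
Proof.
move=> C0 Cd; rewrite mulr_gt0 // powR_gt0 //.
by apply: lt_le_trans Cd; rewrite exprn_gt0.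
Qed.

Lemma lam_of4 C d : 0 < C -> C ^+ 4 <= d%:R -> lam_of C d ^+ 4 * d%:R = C ^+ 4.
Proof.
move=> C0 Cd; have d0 : 0 < d%:R :> R by apply: lt_le_trans Cd; rewrite exprn_gt0.
have e : (- 4^-1) * 4%:R = - 1 :> R by field.
rewrite /lam_of exprMn -[X in _ * X * _]powR_mulrn ?powR_ge0 // -powRrM e.
by rewrite powR_inv1 ?ltW // -mulrA mulVf ?mulr1 // lt0r_neq0.
Qed.

Lemma lam_of2 C d : 0 < C -> C ^+ 4 <= d%:R ->
  lam_of C d ^+ 2 * Num.sqrt d%:R = C ^+ 2.
Proof.
move=> C0 Cd; have l0 := lam_of_gt0 C0 Cd.
apply/eqP; rewrite -(@eqrXn2 _ 2) //; last 2 first.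
- by apply: mulr_ge0; [exact: sqr_ge0|exact: sqrtr_ge0].
- exact: sqr_ge0.
rewrite exprMn sqr_sqrtr // -!exprM lam_of4 //.
Qed.

Lemma lam_of_le1 C d : 0 < C -> C ^+ 4 <= d%:R -> lam_of C d <= 1.
Proof.
move=> C0 Cd; have l0 := lam_of_gt0 C0 Cd.
have d0 : 0 < d%:R :> R by apply: lt_le_trans Cd; rewrite exprn_gt0.
by rewrite -(@expr_le1 _ 4 _ isT (ltW l0)) -(ler_pM2r d0) lam_of4 // mul1r.
Qed.

End LowerBound.

Section LowerBoundParts.
Variable R : realType.
Implicit Types (C alpha lam : R) (d n : nat).

(** The log-free bound: a rate of at most 1/720 makes rho <= 1/2, and 11520 = 2 * 2 * 2880. The free
    numerator [u <= 2] absorbs the logarithmic factors of the stated bounds. *)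
Lemma memo_ge_small_rate d n lam (A : sample d n -> classifier d -> R) alpha (u : R) :
  0 < lam -> is_algo A -> 0 < alpha -> alpha < 2^-1 -> err_alg lam A <= alpha ->
  (0 < n)%N -> lam ^+ 2 * n%:R <= 720^-1 -> u <= 2 ->
  info_const R / 11520 * (u / (lam ^+ 4 * n%:R) * C_alpha alpha) <= memo lam A.
Proof.
move=> l0 algoA a0 a1 errA n0 small u2.
have n1 : 1 <= n%:R :> R by rewrite ler1n.
have l20 := sqr_ge0 lam.
have l2 : lam ^+ 2 <= 2^-1 ^+ 2.
  have : lam ^+ 2 * 1 <= lam ^+ 2 * n%:R by apply: ler_wpM2l.
  lra.
have lh : lam <= 2^-1.
  by rewrite -ler_sqr ?nnegrE ?invr_ge0 // ltW.
have := memo_ge_C_alpha l0 ltac:(lra) algoA a0 a1 errA n0 lh ltac:(lra).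
have x0 : 0 < lam ^+ 4 * n%:R by apply: mulr_gt0; [exact: exprn_gt0|rewrite ltr0n].
have i0 := info_const_gt0 R; have c0 := C_alpha_gt0 a0 a1.
move: (info_const R) (C_alpha alpha) i0 c0 => i c i0 c0 h.
have ic : 0 < i * c by apply: mulr_gt0.
have h2 : 2^-1 * (i * c) <= 2880 * lam ^+ 4 * n%:R * memo lam A.
  by apply: le_trans h; apply: ler_wpM2r; [exact: ltW|lra].
have -> : i / 11520 * (u / (lam ^+ 4 * n%:R) * c) = (i * c * u / 11520) / (lam ^+ 4 * n%:R).
  by field; rewrite !lt0r_neq0 // ltr0n.
rewrite ler_pdivrMr //.
have : i * c * u <= i * c * 2 by apply: ler_wpM2l => //; apply: ltW.
lra.
Qed.

Section Fixed.
Variables (C : R) (d n : nat) (M : {set classifier d}).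
Variables (A : sample d n -> classifier d -> R) (alpha : R).
Hypotheses (C0 : expR 30 <= C) (Cd : C ^+ 4 <= d%:R) (n0 : (0 < n)%N).
Hypotheses (alpha0 : 0 < alpha) (alpha1 : alpha < 1 / 2).
Hypotheses (algoA : is_algo A) (AM : outputs_in A M).
Hypothesis errA : err_alg (lam_of C d) A <= alpha.

Let Cpos : 0 < C. Proof. exact: lt_le_trans (expR_gt0 _) C0. Qed.
Let alpha2 : alpha < 2^-1. Proof. by move: alpha1; lra. Qed.
Let l0 : 0 < lam_of C d. Proof. exact: lam_of_gt0. Qed.
Let l1 : lam_of C d <= 1. Proof. exact: lam_of_le1. Qed.
Let n1 : 1 <= n%:R :> R. Proof. by rewrite ler1n. Qed.
Let d0 : 0 < d%:R :> R. Proof. by apply: lt_le_trans Cd; rewrite exprn_gt0. Qed.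
Let memo0 : 0 <= memo (lam_of C d) A. Proof. exact: memo_ge0. Qed.

(** Since d >= C^4 >= e^120. The exponent 90 is chosen because 8 * 90 = 720, the threshold of
    [memo_ge_small_rate]. *)
Lemma info_const_dim : expR 90 <= info_const R * d%:R.
Proof.
apply: (@le_trans _ _ (info_const R * C ^+ 4)); last first.
  by apply: ler_wpM2l => //; apply: ltW; apply: info_const_gt0.
have : expR 30 ^+ 4 <= C ^+ 4 by apply: lerXn2r => //; rewrite nnegrE ltW ?expR_gt0.
rewrite -expRM_natl => h.
apply: (@le_trans _ _ (info_const R * expR (4%:R * 30))); last first.
  by apply: ler_wpM2l => //; apply: ltW; apply: info_const_gt0.
rewrite /info_const mulrAC -expRD ler_pdivlMr //.
have -> : - 4 + 4%:R * 30 = 90 + 26 :> R by ring.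
rewrite (expRD 90 26); apply: ler_wpM2l; first exact: expR_ge0.
by have := expR_ge1Dx (26 : R); lra.
Qed.

(** An algorithm of error [alpha] needs enough classifiers: [C_alpha alpha] is at most a constant
    times [ln #|M|], so the ratio is at least of order [d]. *)
Lemma card_ratio_ge : expR 90 <= d%:R * ln #|M|%:R / C_alpha alpha.
Proof.
apply: (le_trans info_const_dim); rewrite ler_pdivlMr ?C_alpha_gt0 //.
rewrite [leLHS]mulrAC mulrC; apply: ler_wpM2l; first exact: ltW.
exact: (C_alpha_le_ln_card l0 l1 algoA alpha0 alpha2 errA AM).
Qed.

Lemma memo_lower_bound :
  let lam := lam_of C d in
  let L := ln (d%:R * n%:R * ln (#|M|%:R) / C_alpha alpha) in
  info_const R / 11520 * ((1 - 8 * lam ^+ 2 * n%:R * L) / (lam ^+ 4 * n%:R * L) * C_alpha alpha)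
       <= memo lam A.
Proof.
rewrite /=; set lam := lam_of C d; set L := ln _.
have c0 := C_alpha_gt0 alpha0 alpha2.
have L90 : 90 <= L.
  rewrite -[leLHS]expRK ler_ln ?posrE ?expR_gt0 //.
    apply: (le_trans card_ratio_ge); rewrite ler_pM2r ?invr_gt0 //.
    rewrite [leRHS]mulrAC ler_peMr //.
    apply: mulr_ge0; first exact: ltW.
    apply: le_trans (C_alpha_le_ln_card l0 l1 algoA alpha0 alpha2 errA AM).
    by apply: mulr_ge0; apply: ltW => //; apply: info_const_gt0.
  apply: lt_le_trans (expR_gt0 90) _; apply: (le_trans card_ratio_ge).
  rewrite ler_pM2r ?invr_gt0 //.
  rewrite [leRHS]mulrAC ler_peMr //.
  apply: mulr_ge0; first exact: ltW.
  apply: le_trans (C_alpha_le_ln_card l0 l1 algoA alpha0 alpha2 errA AM).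
  by apply: mulr_ge0; apply: ltW => //; apply: info_const_gt0.
have L0 : 0 < L by lra.
have x0 : 0 < lam ^+ 4 * n%:R by apply: mulr_gt0; [exact: exprn_gt0|rewrite ltr0n].
have i0 := info_const_gt0 R.
(* A nonpositive numerator makes the claim trivial; a positive one, with [L >= 90], puts
   [lam ^+ 2 * n] below 1/720. *)
have [neg|pos] := lerP (1 - 8 * lam ^+ 2 * n%:R * L) 0.
  apply: le_trans memo0; apply: mulr_ge0_le0; first by lra.
  apply: mulr_le0_ge0; last exact: ltW.
  apply: mulr_le0_ge0 => //; rewrite invr_ge0; apply: mulr_ge0; exact: ltW.
have y0 : 0 <= lam ^+ 2 * n%:R by apply: mulr_ge0 => //; apply: sqr_ge0.
have : lam ^+ 2 * n%:R * 90 <= lam ^+ 2 * n%:R * L by apply: ler_wpM2l.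
move=> y90.
have -> : (1 - 8 * lam ^+ 2 * n%:R * L) / (lam ^+ 4 * n%:R * L) =
   (1 - 8 * lam ^+ 2 * n%:R * L) / L / (lam ^+ 4 * n%:R).
  rewrite invfM mulrA; ring.
apply: memo_ge_small_rate => //; first by lra.
rewrite ler_pdivrMr //.
have : 0 <= lam ^+ 2 * n%:R * L by apply: mulr_ge0 => //; exact: ltW.
lra.
Qed.

Hypothesis nsmall : n%:R <= info_const R / (11520 * C ^+ 2) * Num.sqrt (d%:R : R) /
  ln (d%:R * ln (#|M|%:R) / C_alpha alpha).

(** The factor C^2 in the denominator of the assumption cancels against lam^2 sqrt d = C^2; the
    logarithm there is at least 90, so dividing by it only helps. *)
Lemma small_rate : lam_of C d ^+ 2 * n%:R <= info_const R / 11520.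
Proof.
have i0 := info_const_gt0 R.
have C20 : 0 < C ^+ 2 by rewrite exprn_gt0.
have D1 : 1 <= ln (d%:R * ln #|M|%:R / C_alpha alpha).
  apply: (@le_trans _ _ 90); first by lra.
  rewrite -[leLHS]expRK ler_ln ?posrE ?expR_gt0 ?card_ratio_ge //.
  exact: lt_le_trans (expR_gt0 90) card_ratio_ge.
have : n%:R <= info_const R / (11520 * C ^+ 2) * Num.sqrt (d%:R : R).
  apply: (le_trans nsmall); rewrite ler_pdivrMr; last by lra.
  rewrite ler_peMr // mulr_ge0 ?sqrtr_ge0 // divr_ge0 //; first exact: ltW.
  by apply: mulr_ge0 => //; exact: ltW.
have l20 := sqr_ge0 (lam_of C d).
move=> /(ler_wpM2l l20) h; apply: (le_trans h).
have -> : lam_of C d ^+ 2 * (info_const R / (11520 * C ^+ 2) * Num.sqrt d%:R) =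
  info_const R / (11520 * C ^+ 2) * (lam_of C d ^+ 2 * Num.sqrt d%:R) by ring.
rewrite lam_of2 // le_eqVlt; apply/orP; left; apply/eqP.
by field; apply: lt0r_neq0.
Qed.

Lemma info_const_le1 : info_const R <= 16^-1.
Proof.
have : expR (- 4) <= 1 :> R by rewrite expR_le1; lra.
rewrite /info_const; lra.
Qed.

(** Without [ln #|M|] the logarithm is only shown to be at least 1/2, so smallness of the rate comes
    from the assumption on [n]. This is why [memo_ge_small_rate] admits numerators up to 2. *)
Lemma memo_lower_bound_small :
  let lam := lam_of C d in
  let L := ln (d%:R * n%:R / C_alpha alpha) in
  info_const R / 11520 * ((1 - 8 * lam ^+ 2 * n%:R * L) / (lam ^+ 4 * n%:R * L) * C_alpha alpha)
       <= memo lam A.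
Proof.
rewrite /=; set lam := lam_of C d; set L := ln _.
have c0 := C_alpha_gt0 alpha0 alpha2.
have i0 := info_const_gt0 R; have i1 := info_const_le1.
have sr := small_rate; rewrite -/lam in sr.
have x0 : 0 < lam ^+ 4 * n%:R by apply: mulr_gt0; [exact: exprn_gt0|rewrite ltr0n].
have l20 := sqr_ge0 lam.
have y1 : lam ^+ 2 * 1 <= lam ^+ 2 * n%:R by apply: ler_wpM2l.
(* From [C_alpha_le_dim], as [lam ^+ 2] is itself below the small rate; hence the argument of [L] is
   at least 2. *)
have cd : C_alpha alpha <= d%:R / 2.
  rewrite -(ler_pM2l i0).
  apply: (le_trans (C_alpha_le_dim l0 l1 algoA alpha0 alpha2 errA)); rewrite -/lam.
  have : lam ^+ 2 * d%:R <= info_const R / 11520 * d%:R.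
    by apply: ler_wpM2r; [exact: ltW|lra].
  have : 0 <= info_const R * d%:R by apply: mulr_ge0; exact: ltW.
  lra.
have L2 : 2^-1 <= L.
  apply: (@le_trans _ _ (ln 2)).
    rewrite -[leRHS]opprK lerNr -lnV ?posrE //.
    have := @ln_le_subr1 R 2^-1 ltac:(lra); lra.
  rewrite ler_ln ?posrE //; last by rewrite divr_gt0 // mulr_gt0 // ltr0n.
  rewrite ler_pdivlMr //.
  have : d%:R * 1 <= d%:R * n%:R :> R by apply: ler_wpM2l => //; exact: ltW.
  lra.
have L0 : 0 < L by lra.
have -> : (1 - 8 * lam ^+ 2 * n%:R * L) / (lam ^+ 4 * n%:R * L) =
   (1 - 8 * lam ^+ 2 * n%:R * L) / L / (lam ^+ 4 * n%:R).
  rewrite invfM mulrA; ring.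
apply: memo_ge_small_rate => //; first by rewrite -/lam; lra.
rewrite ler_pdivrMr //.
have : 0 <= lam ^+ 2 * n%:R * L.
  by apply: mulr_ge0; [apply: mulr_ge0|exact: ltW].
lra.
Qed.

Lemma memo_lower_bound_dim :
  info_const R / 11520 * (2 / C ^+ 4 * C_alpha alpha) * d%:R / n%:R <= memo (lam_of C d) A.
Proof.
have i0 := info_const_gt0 R; have i1 := info_const_le1.
have sr := small_rate.
have := @memo_ge_small_rate d n _ A alpha 2 l0 algoA alpha0 alpha2 errA n0 ltac:(lra) ltac:(lra).
apply: le_trans; rewrite le_eqVlt; apply/orP; left; apply/eqP.
rewrite -(lam_of4 Cpos Cd); field.
by rewrite !lt0r_neq0 // ltr0n.
Qed.

End Fixed.
End LowerBoundParts.

(** * Majority votes *)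

Section Majority.
Variable R : realType.
Implicit Types (lam : R) (n : nat).

(** [None], of value 0, stands both for a tied vote and for a coordinate that is not stored; three
    labels per stored coordinate give the count 3^|D|. *)
Definition label := option bool.

Definition label_val (o : label) : R := oapp (@sg R) 0 o.

Definition majority n (v : column n) : label :=
  if column_sum R v == 0 then None else Some (0 < column_sum R v).

Definition maj n (v : column n) : R := label_val (majority v).

Lemma majE n (v : column n) : maj v = Num.sg (column_sum R v).
Proof. by rewrite /maj /majority; case: sgrP. Qed.

Lemma label_val_sqr_le1 o : label_val o ^+ 2 <= 1.
Proof. by case: o => [b|] /=; rewrite /label_val /= ?expr0n // expr2 sg_sqr. Qed.

Lemma maj_flip n (v : column n) : maj (flip v) = - maj v.
Proof. by rewrite !majE column_sum_flip sgrN. Qed.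

Definition majority_bias n lam : R := expect (column_pmf lam true) (@maj n).

Lemma expect_maj n lam b :
  expect (column_pmf lam b) (@maj n) = sg R b * majority_bias n lam.
Proof.
case: b; first by rewrite mul1r.
rewrite mulN1r /majority_bias /expect sum_flip -sumrN; apply: eq_bigr => v _.
by rewrite column_pmf_flip maj_flip mulrN.
Qed.

(** Each observation contributes (1 + lam) (1 - lam) / 4 whatever its sign, so the geometric mean of
    the two likelihoods is the same for all columns. *)
Lemma column_pmf_mul n lam (v : column n) :
  column_pmf lam true v * column_pmf lam false v = ((1 - lam ^+ 2) / 4) ^+ n.
Proof.
rewrite /column_pmf /prodm -big_split -[n in RHS]card_ord -prodr_const.
by apply: eq_bigr => j _; rewrite !bsc1E /sg; case: (v j) => /=; field.
Qed.

Lemma column_pmf_le_of_sum_le0 n lam (v : column n) : (0 < n)%N ->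
  0 <= lam -> lam <= 1 -> column_sum R v <= 0 ->
  column_pmf lam true v <= column_pmf lam false v.
Proof.
(* At [lam = 1] the log-odds degenerate; there, one negative observation already has likelihood
   0. *)
move=> n0 l0; rewrite le_eqVlt => /orP[/eqP ->|l1] S0.
  have [/existsP[j vj]|/existsPn vt] := boolP [exists j, ~~ v j].
    rewrite /column_pmf /prodm (bigD1 j) //= bsc1E /sg /= (negbTE vj) !mul1r subrr !mul0r.
    by apply: column_pmf_ge0; lra.
  exfalso; move: S0; rewrite /column_sum (eq_bigr (fun=> 1)) => [|j _].
    by rewrite sumr_const card_ord lern0 -leqn0 leqNgt n0.
  by have := vt j; rewrite negbK => ->.
rewrite column_pmf_true_false //; rewrite ler_piMr //.
  by apply: column_pmf_ge0; lra.
rewrite expR_le1; apply: mulr_ge0_le0 => //.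
by apply: ln_ge0; rewrite ler_pdivlMr; lra.
Qed.

(** Bhattacharyya bound: on this event the true likelihood is at most the geometric mean (s / 2)^n,
    and there are 2^n columns. *)
Lemma prob_minority n lam : (0 < n)%N -> 0 <= lam -> lam <= 1 ->
  expect (column_pmf lam true) (fun v : column n => (column_sum R v <= 0)%R%:R) <=
  Num.sqrt (1 - lam ^+ 2) ^+ n.
Proof.
move=> n0 l0 l1; set s := Num.sqrt _.
have lam2 : 0 <= 1 - lam ^+ 2.
  by rewrite subr_ge0; apply: exprn_ile1.
have s0 : 0 <= s by apply: sqrtr_ge0.
have -> : s ^+ n = \sum_(v : column n) (s / 2) ^+ n.
  rewrite sumr_const card_ffun card_bool card_ord -(mulr_natl _ (2 ^ n)) natrX -exprMn.
  by congr (_ ^+ n); field.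
apply: ler_sum => v _; case: (lerP (column_sum R v) 0) => [S0|_]; last first.
  by rewrite mulr0 exprn_ge0 // divr_ge0.
have a0 : 0 <= column_pmf lam true v by apply: column_pmf_ge0; lra.
rewrite mulr1 -ler_sqr ?nnegrE ?exprn_ge0 ?divr_ge0 //.
rewrite -exprM mulnC exprM expr_div_n sqr_sqrtr // -natrX.
have -> : (2 ^ 2)%:R = 4 :> R by [].
rewrite -(column_pmf_mul lam v) expr2; apply: ler_wpM2l => //.
exact: column_pmf_le_of_sum_le0.
Qed.

Lemma prob_majority_wrong n lam b : (0 < n)%N -> 0 <= lam -> lam <= 1 ->
  expect (column_pmf lam b) (fun v : column n => (majority v != Some b)%:R) <=
  Num.sqrt (1 - lam ^+ 2) ^+ n.
Proof.
move=> n0 l0 l1; apply: le_trans (prob_minority n0 l0 l1).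
have E v : (majority v != Some true) = (column_sum R v <= 0).
  by rewrite /majority; case: ltrgtP.
case: b; first by under eq_expect do rewrite E.
rewrite /expect [leLHS]sum_flip; apply: ler_sum => v _; rewrite column_pmf_flip /=.
apply: ler_wpM2l; first by apply: column_pmf_ge0; lra.
rewrite /majority column_sum_flip oppr_eq0 oppr_gt0.
by case: ltrgtP.
Qed.

Lemma majority_bias_ge_prob n lam : (0 < n)%N -> 0 <= lam -> lam <= 1 ->
  1 - 2 * Num.sqrt (1 - lam ^+ 2) ^+ n <= majority_bias n lam.
Proof.
move=> n0 l0 l1; have := prob_minority n0 l0 l1.
set P := expect _ _; suff : 1 - 2 * P <= majority_bias n lam by lra.
rewrite /P -[X in X - _](expect_cst 1 (sum_column_pmf n lam true)) -expectZ -expectB.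
apply: ler_expect => v; first by apply: column_pmf_ge0; lra.
rewrite majE; case: sgrP => h; rewrite ?h ?lexx ?(ltW h) ?leNgt ?h /=; lra.
Qed.

Lemma column_sum_fcons n b (F : column n) :
  column_sum R (fcons b F) = sg R b + column_sum R F.
Proof.
rewrite /column_sum big_ord_recl fcons0; congr (_ + _).
by apply: eq_bigr => i _; rewrite fconsS.
Qed.

Lemma sum_sqr_column_sum n :
  \sum_(v : column n) column_sum R v ^+ 2 = 2 ^+ n * n%:R.
Proof.
elim: n => [|n IH].
  by rewrite mulr0; apply: big1 => v _; rewrite /column_sum big_ord0 expr0n.
rewrite sum_fcons big_bool /= -big_split /=.
under eq_bigr => F _.
  rewrite !column_sum_fcons /sg.
  have -> : (1 + column_sum R F) ^+ 2 + (-1 + column_sum R F) ^+ 2 =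
     2 * column_sum R F ^+ 2 + 2 by ring.
  over.
rewrite big_split /= -mulr_sumr IH sumr_const card_ffun card_bool card_ord.
by rewrite -(mulr_natl _ (2 ^ n)) natrX [2 ^+ n.+1]exprS -[n.+1%:R]natr1; ring.
Qed.

Lemma sum_pow4_column_sum n :
  \sum_(v : column n) column_sum R v ^+ 4 = 2 ^+ n * (3 * n%:R ^+ 2 - 2 * n%:R).
Proof.
elim: n => [|n IH].
  rewrite expr0n /= !mulr0 subrr mulr0.
  by apply: big1 => v _; rewrite /column_sum big_ord0 expr0n.
rewrite sum_fcons big_bool /= -big_split /=.
under eq_bigr => F _.
  rewrite !column_sum_fcons /sg.
  have -> : (1 + column_sum R F) ^+ 4 + (-1 + column_sum R F) ^+ 4 =
     2 * column_sum R F ^+ 4 + 12 * column_sum R F ^+ 2 + 2 by ring.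
  over.
rewrite !big_split /= -!mulr_sumr IH sum_sqr_column_sum sumr_const card_ffun card_bool card_ord.
by rewrite -(mulr_natl _ (2 ^ n)) natrX [2 ^+ n.+1]exprS -[n.+1%:R]natr1; ring.
Qed.

(* The fourth-moment method: integrate [|S| >= S^2 / r - S^4 / (4 r^3)] with
   [r = 2 sqrt n]. *)
Lemma sum_norm_column_sum n : (0 < n)%N ->
  2 ^+ n * (2 / 5 * Num.sqrt n%:R) <= \sum_(v : column n) `|column_sum R v|.
Proof.
move=> n0; set q := Num.sqrt _; have q0 : 0 < q by rewrite sqrtr_gt0 ltr0n.
have q2 : q ^+ 2 = n%:R by rewrite sqr_sqrtr.
pose r := 2 * q.
have r0 : 0 < r by rewrite mulr_gt0.
have key x : x ^+ 2 / r - x ^+ 4 / (4 * r ^+ 3) <= `|x|.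
  have -> : x ^+ 2 = `|x| ^+ 2 by rewrite real_normK ?num_real.
  have -> : x ^+ 4 = `|x| ^+ 4.
    by rewrite -[4%N]/(2 * 2)%N !exprM real_normK ?num_real.
  move: `|x| (normr_ge0 x) => {x} x x0.
  pose y := x / r; have y0 : 0 <= y by apply: divr_ge0 => //; exact: ltW.
  have -> : x = r * y by rewrite /y; field; apply: lt0r_neq0.
  have -> : (r * y) ^+ 2 / r - (r * y) ^+ 4 / (4 * r ^+ 3) = r * (y ^+ 2 - y ^+ 4 / 4).
    by field; apply: lt0r_neq0.
  apply: ler_wpM2l; first exact: ltW.
  suff : 0 <= y * (1 - y + y ^+ 3 / 4).
    have -> : y * (1 - y + y ^+ 3 / 4) = y - y ^+ 2 + y ^+ 4 / 4 by ring.
    lra.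
  apply: mulr_ge0 => //.
  have -> : 1 - y + y ^+ 3 / 4 = (y - 1) ^+ 2 * (y + 2) / 4 + (2 - y) / 4 + 0 by field.
  (* The tangent bound y^3 >= 3 a^2 y - 2 a^3 at a = 6/5, close to the minimiser 2 / sqrt 3 of 1 - y
     + y^3 / 4. *)
  have : 0 <= (y - 6 / 5) ^+ 2 * (y + 12 / 5).
    by apply: mulr_ge0; [exact: sqr_ge0|lra].
  lra.
apply: (@le_trans _ _ (\sum_(v : column n)
    (column_sum R v ^+ 2 / r - column_sum R v ^+ 4 / (4 * r ^+ 3)))); last exact: ler_sum.
rewrite sumrB -!mulr_suml sum_sqr_column_sum sum_pow4_column_sum -!q2 /r.
have -> : 2 ^+ n * q ^+ 2 / (2 * q) -
  2 ^+ n * (3 * (q ^+ 2) ^+ 2 - 2 * q ^+ 2) / (4 * (2 * q) ^+ 3) =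
  2 ^+ n * (13 / 32 * q + q^-1 / 16).
  by field; apply: lt0r_neq0.
apply: ler_wpM2l; first exact: exprn_ge0.
have : 0 < q^-1 by rewrite invr_gt0.
lra.
Qed.

(** With q the common geometric mean and y the log-likelihood ratio, the likelihoods are q e^(y/2)
    and q e^(-y/2). For y >= 0 their difference is at least q y / 2, and y >= lam S because the
    log-odds are at least [lam]. *)
Lemma maj_pmf_diff_ge n lam (v : column n) : 0 <= lam -> lam < 1 ->
  (Num.sqrt (1 - lam ^+ 2) / 2) ^+ n * (lam / 2) * `|column_sum R v| <=
  (column_pmf lam true v - column_pmf lam false v) * maj v.
Proof.
move=> l0 l1; set s := Num.sqrt _.
wlog S0 : v / 0 <= column_sum R v => [h|].
  have [/h //|S0] := lerP 0 (column_sum R v).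
  have := h (flip v); rewrite column_sum_flip normrN maj_flip !column_pmf_flip /=.
  move=> /(_ ltac:(lra)); rewrite -opprB mulrNN; exact.
have lam2 : 0 < 1 - lam ^+ 2 by rewrite subr_gt0; apply: exprn_ilt1.
have s0 : 0 < s by rewrite sqrtr_gt0.
rewrite ger0_norm //.
have [S00|Sn] := eqVneq (column_sum R v) 0.
  by rewrite majE S00 sgr0 !mulr0.
have Sp : 0 < column_sum R v by rewrite lt_neqAle eq_sym Sn.
rewrite majE gtr0_sg // mulr1.
pose y := log_odds lam * column_sum R v.
have lo : 0 < (1 + lam) / (1 - lam) by apply: divr_gt0; lra.
have ly : lam * column_sum R v <= y.
  apply: ler_wpM2r => //; rewrite /log_odds -[leRHS]opprK -lnV ?posrE //.
  rewrite invf_div lerNr.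
  have := @ln_le_subr1 R ((1 - lam) / (1 + lam)) ltac:(apply: divr_gt0; lra).
  suff : (1 - lam) / (1 + lam) - 1 <= - lam by lra.
  have -> : (1 - lam) / (1 + lam) - 1 = - ((2 * lam) / (1 + lam)) by field; apply: lt0r_neq0; lra.
  rewrite lerN2 ler_pdivlMr; last by lra.
  have : 0 <= lam * (1 - lam) by apply: mulr_ge0; lra.
  lra.
have ab := column_pmf_mul lam v; have aE := column_pmf_true_false v l0 l1.
have b0 : 0 <= column_pmf lam false v by apply: column_pmf_ge0; lra.
move: (column_pmf lam true v) (column_pmf lam false v) ab aE b0 => a b ab aE b0.
set q := (s / 2) ^+ n.
have q0 : 0 <= q by apply: exprn_ge0; apply: divr_ge0 => //; exact: ltW.
have q2 : q ^+ 2 = a * b.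
  rewrite ab /q -exprM mulnC exprM expr_div_n sqr_sqrtr ?ltW // -natrX.
  by [].
have bE : b = q * expR (- (y / 2)).
  apply/eqP; rewrite -(@eqrXn2 _ 2) // ?mulr_ge0 ?expR_ge0 //.
  rewrite exprMn q2 aE -expRM_natl mulrN -/y.
  have -> : 2%:R * (y / 2) = y by field.
  by rewrite mulrAC -[b * _ * _]mulrA expRxMexpNx_1 mulr1 expr2.
have aE' : a = q * expR (y / 2).
  rewrite aE bE -mulrA -expRD -/y; have -> : - (y / 2) + y = y / 2 by field.
  by [].
rewrite aE' bE -mulrBr -mulrA; apply: ler_wpM2l => //.
have y0 : 0 <= y by apply: le_trans ly; apply: mulr_ge0.
have := expR_ge1Dx (y / 2).
have : expR (- (y / 2)) <= 1 by rewrite expR_le1; lra.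
lra.
Qed.

Lemma majority_bias_ge_sqrt n lam : (0 < n)%N -> 0 <= lam -> lam < 1 ->
  Num.sqrt (1 - lam ^+ 2) ^+ n * (lam * Num.sqrt n%:R / 10) <= majority_bias n lam.
Proof.
move=> n0 l0 l1; set s := Num.sqrt (1 - _); set q := Num.sqrt n%:R.
have s0 : 0 <= s by apply: sqrtr_ge0.
have -> : majority_bias n lam =
    2^-1 * \sum_v (column_pmf lam true v - column_pmf lam false v) * @maj n v.
  under eq_bigr do rewrite mulrBl.
  rewrite sumrB -/(expect (column_pmf lam true) _) -/(expect (column_pmf lam false) _).
  by rewrite !expect_maj /sg; field.
apply: (@le_trans _ _ (2^-1 * \sum_(v : column n) (s / 2) ^+ n * (lam / 2) * `|column_sum R v|)).
  rewrite -mulr_sumr.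
  have := sum_norm_column_sum n0; rewrite -/q.
  have c0 : 0 <= (s / 2) ^+ n * (lam / 2).
    by apply: mulr_ge0; [apply: exprn_ge0; apply: divr_ge0|lra].
  move=> /(ler_wpM2l c0).
  have -> : (s / 2) ^+ n * (lam / 2) * (2 ^+ n * (2 / 5 * q)) =
     ((s / 2) ^+ n * 2 ^+ n) * (lam * q / 5) by field.
  by rewrite -exprMn divfK //; lra.
apply: ler_wpM2l; first by rewrite invr_ge0.
by apply: ler_sum => v _; apply: maj_pmf_diff_ge.
Qed.

(** Split at s^n = 1/4, with s = sqrt (1 - lam^2): below, a wrong majority is unlikely; above, the
    factor s^n in [majority_bias_ge_sqrt] costs only a factor 4. *)
Lemma majority_bias_ge n lam : (0 < n)%N -> 0 <= lam -> lam <= 1 ->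
  2^-1 <= majority_bias n lam \/ lam * Num.sqrt n%:R / 40 <= majority_bias n lam.
Proof.
move=> n0 l0 l1; have h := majority_bias_ge_prob n0 l0 l1.
have [small|large] := lerP (Num.sqrt (1 - lam ^+ 2) ^+ n) 4^-1.
  by left; lra.
right; have l2 : lam < 1.
  rewrite lt_neqAle l1 andbT; apply/eqP => e; move: large.
  by rewrite e expr1n subrr sqrtr0 expr0n; case: n n0 {h} => //= n _; lra.
apply: le_trans (majority_bias_ge_sqrt n0 l0 l2).
have c0 : 0 <= lam * Num.sqrt n%:R / 10 by apply: divr_ge0 => //; apply: mulr_ge0 => //; apply: sqrtr_ge0.
have := ler_wpM2r c0 (ltW large); lra.
Qed.

End Majority.

(** * Second moments and the majority-vote classifier *)

Section SecondMoment.
Variables (R : realType) (I V : finType).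
Implicit Types (k : I -> V -> R) (u : I -> V -> R).

Lemma expect_prod_prodm k u :
  expect (prodm k) (fun Y => \prod_i u i (Y i)) = \prod_i expect (k i) (u i).
Proof.
rewrite /expect bigA_distr_bigA; apply: eq_bigr => Y _.
by rewrite -big_split.
Qed.

Lemma expect_coord_prodm k (i : I) (f : V -> R) :
  (forall i, \sum_v k i v = 1) ->
  expect (prodm k) (fun Y => f (Y i)) = expect (k i) f.
Proof.
move=> k1; transitivity (expect (prodm k)
    (fun Y => \prod_j (if j == i then f else fun=> 1) (Y j))).
  apply: eq_expect => Y; rewrite (bigD1 i) //= eqxx big1 ?mulr1 // => j ji.
  by rewrite (negbTE ji).
rewrite (expect_prod_prodm k (fun j => if j == i then f else fun=> 1)).
rewrite (bigD1 i) //= eqxx big1 ?mulr1 // => j ji.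
by rewrite (negbTE ji) expect_cst.
Qed.

Lemma expect_coord2_prodm k (i j : I) (f g : V -> R) :
  (forall i, \sum_v k i v = 1) -> i != j ->
  expect (prodm k) (fun Y => f (Y i) * g (Y j)) = expect (k i) f * expect (k j) g.
Proof.
move=> k1 ij; have ji : j != i by rewrite eq_sym.
pose h (l : I) := if l == i then f else if l == j then g else fun=> 1.
transitivity (expect (prodm k) (fun Y => \prod_l h l (Y l))).
  apply: eq_expect => Y; rewrite (bigD1 i) //= (bigD1 j) //= /h eqxx (negbTE ji) eqxx.
  rewrite big1 ?mulr1 // => l /andP[li lj].
  by rewrite (negbTE li) (negbTE lj).
rewrite expect_prod_prodm (bigD1 i) //= (bigD1 j) //= /h eqxx (negbTE ji) eqxx.
rewrite big1 ?mulr1 // => l /andP[li lj].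
by rewrite (negbTE li) (negbTE lj) expect_cst.
Qed.

Lemma second_moment_prodm k u (c : I -> R) :
  (forall i, \sum_v k i v = 1) -> (forall i, expect (k i) (u i) = 0) ->
  (forall i, expect (k i) (fun v => u i v ^+ 2) <= c i) ->
  expect (prodm k) (fun Y => (\sum_i u i (Y i)) ^+ 2) <= \sum_i c i.
Proof.
move=> k1 u0 uc.
rewrite (@eq_expect _ _ _ _ (fun Y : {ffun I -> V} => \sum_i \sum_j u i (Y i) * u j (Y j))); last first.
  by move=> Y; rewrite expr2 mulr_suml; apply: eq_bigr => i _; rewrite mulr_sumr.
rewrite expect_sum; apply: ler_sum => i _; rewrite expect_sum (bigD1 i) //= big1.
  by rewrite addr0 (expect_coord_prodm i (fun v => u i v * u i v)) //; exact: uc.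
by move=> j ji; rewrite expect_coord2_prodm 1?eq_sym // u0 mul0r.
Qed.

End SecondMoment.

Section MajorityAlgorithm.
Variables (R : realType) (d : nat).
Implicit Types (lam tau : R) (n : nat) (D : {set 'I_d}) (th x : cube d).

Definition weights := {ffun 'I_d -> label}.

Definition correlation (w : weights) x : R := \sum_i label_val R (w i) * sg R (x i).

Definition threshold tau (w : weights) : classifier d :=
  [ffun x => tau <= correlation w x].

Definition restrict D (f : 'I_d -> label) : weights :=
  [ffun i => if i \in D then f i else None].

Definition majorities n D (X : sample d n) : weights :=
  restrict D (fun i => majority R [ffun j => X j i]).

Definition majority_algo n D tau (X : sample d n) (h : classifier d) : R :=
  (h == threshold tau (majorities D X))%:R.

Definition restricted_weights D : {set weights} :=
  [set w in pffun_on None (mem D) predT].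

Lemma restrictP D f : restrict D f \in restricted_weights D.
Proof.
rewrite inE; apply/pffun_onP; split => //.
by apply/subsetP => i; rewrite inE /= ffunE; case: ifP => // _; rewrite eqxx.
Qed.

Lemma card_restricted_weights D : #|restricted_weights D| = (3 ^ #|D|)%N.
Proof. by rewrite cardsE card_pffun_on card_option card_bool. Qed.

Lemma majorities_transpose n D (Y : {ffun 'I_d -> column n}) :
  majorities D (transpose Y) = restrict D (fun i => majority R (Y i)).
Proof.
apply/ffunP => i; rewrite !ffunE; case: ifP => // _; congr majority.
by apply/ffunP => j; rewrite !ffunE.
Qed.

Lemma is_algo_majority n D tau : is_algo (@majority_algo n D tau).
Proof.
move=> X; split => [h|]; first by rewrite /majority_algo.
rewrite (bigD1 (threshold tau (majorities D X))) //= /majority_algo eqxx.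
by rewrite big1 ?addr0 // => h /negbTE ->.
Qed.

Lemma majority_algo_outputs n D tau :
  outputs_in (@majority_algo n D tau) (threshold tau @: restricted_weights D).
Proof.
move=> X h hM; rewrite /majority_algo; case: eqP => // e; case/negP: hM.
by rewrite e; apply: imset_f; exact: restrictP.
Qed.

Lemma label_weight_le D (w : weights) i : w \in restricted_weights D ->
  label_val R (w i) ^+ 2 <= (i \in D)%:R.
Proof.
rewrite inE => /pffun_onP[/subsetP wD _].
case: (boolP (i \in D)) => iD; first exact: label_val_sqr_le1.
case e : (w i) => [b|]; last by rewrite /label_val /= expr0n.
by case/negP: iD; apply: wD; rewrite inE /= e.
Qed.

Lemma sum_mem D : \sum_i (i \in D)%:R = #|D|%:R :> R.
Proof. by rewrite -natr_sum -big_mkcond sum1_card. Qed.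

Lemma correlation_variance D (w : weights) lam th :
  -1 <= lam -> lam <= 1 -> w \in restricted_weights D ->
  expect (bsc_pmf lam th)
    (fun x => (correlation w x - lam * correlation w th) ^+ 2) <= #|D|%:R.
Proof.
move=> l0 l1 wD; rewrite -sum_mem.
rewrite (@eq_expect _ _ _ _ (fun x : cube d =>
   (\sum_i label_val R (w i) * (sg R (x i) - lam * sg R (th i))) ^+ 2)); last first.
  move=> x; congr (_ ^+ 2); rewrite /correlation mulr_sumr -sumrB.
  by apply: eq_bigr => i _; ring.
apply: (second_moment_prodm (k := fun i => bsc1 lam (th i))
  (u := fun i b => label_val R (w i) * (sg R b - lam * sg R (th i)))) => i.
- exact: sum_bsc1.
- rewrite expectZ /expect big_bool /= !bsc1E /sg; case: (th i) => /=; ring.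
apply: le_trans (label_weight_le i wD).
under eq_expect => b do rewrite exprMn.
rewrite expectZ -[leRHS]mulr1; apply: ler_wpM2l; first exact: sqr_ge0.
rewrite /expect big_bool /= !bsc1E /sg.
have -> : (1 + lam * (if th i then 1 else -1) * 1) / 2 * (1 - lam * (if th i then 1 else -1)) ^+ 2
  + (1 + lam * (if th i then 1 else -1) * -1) / 2 * (-1 - lam * (if th i then 1 else -1)) ^+ 2
  = 1 - lam ^+ 2 by case: (th i) => /=; field.
by have := sqr_ge0 lam; lra.
Qed.

(** Multiplying each vote by the true sign gives all stored coordinates the same mean
    [majority_bias n lam]; the terms are independent, of variance at most 1. *)
Lemma alignment_variance n D lam th : 0 <= lam -> lam <= 1 ->
  expect (sample_pmf lam th)
    (fun X : sample d n => (correlation (majorities D X) th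
                            - #|D|%:R * majority_bias n lam) ^+ 2) <= #|D|%:R.
Proof.
move=> l0 l1; rewrite expect_sample_pmf.
set be := majority_bias n lam.
rewrite (@eq_expect _ _ _ _ (fun Y : {ffun 'I_d -> column n} =>
   (\sum_i (i \in D)%:R * (maj R (Y i) * sg R (th i) - be)) ^+ 2)); last first.
  move=> Y; congr (_ ^+ 2); rewrite /correlation -sum_mem mulr_suml -sumrB.
  apply: eq_bigr => i _; rewrite majorities_transpose ffunE /maj.
  by case: (i \in D); rewrite /label_val /= ?mul1r ?mul0r // subrr.
rewrite -sum_mem.
apply: (second_moment_prodm (k := fun i => @column_pmf R n lam (th i))
  (u := fun i v => (i \in D)%:R * (maj R v * sg R (th i) - be))) => i.
- exact: sum_column_pmf.
- rewrite expectZ expectB expect_cst ?sum_column_pmf //.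
  under eq_expect do rewrite mulrC.
  by rewrite expectZ expect_maj mulrA sg_sqr mul1r subrr mulr0.
under eq_expect => v do rewrite exprMn.
rewrite expectZ; case: (i \in D); last by rewrite expr0n mul0r.
rewrite expr1n mul1r (_ : true%:R = 1) //.
have h (v : column n) : (maj R v * sg R (th i) - be) ^+ 2 <=
   1 + be ^+ 2 - (2 * be * sg R (th i)) * maj R v.
  have : maj R v ^+ 2 * sg R (th i) ^+ 2 <= 1.
    by rewrite [sg _ _ ^+ 2]expr2 sg_sqr mulr1; exact: label_val_sqr_le1.
  have -> : (maj R v * sg R (th i) - be) ^+ 2 =
    maj R v ^+ 2 * sg R (th i) ^+ 2 + be ^+ 2 - (2 * be * sg R (th i)) * maj R v by ring.
  lra.
have p0 v : 0 <= @column_pmf R n lam (th i) v by apply: column_pmf_ge0; lra.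
apply: (le_trans (ler_expect p0 h)).
rewrite expectB expectZ expect_cst ?sum_column_pmf // expect_maj -/be.
have -> : 2 * be * sg R (th i) * (sg R (th i) * be) = 2 * be ^+ 2 * (sg R (th i) * sg R (th i)) by ring.
by rewrite sg_sqr; have := sqr_ge0 be; lra.
Qed.

(* Chebyshev's inequality, with the two fluctuations -- of the test point given
   the weights, and of the weights themselves -- treated separately. *)
Lemma err_threshold_le D (w : weights) lam th tau :
  0 < tau -> 0 <= lam -> lam <= 1 -> w \in restricted_weights D ->
  err_h lam th (threshold tau w) <=
  (3 / 2 * #|D|%:R + (lam * correlation w th - 2 * tau) ^+ 2) / tau ^+ 2.
Proof.
move=> t0 l0 l1 wD.
have t2 : 0 < tau ^+ 2 by rewrite exprn_gt0.
have h1 := @correlation_variance D w lam th ltac:(lra) l1 wD.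
(* The null distribution is the channel at [lam = 0], so the same variance bound serves false
   positives. *)
have h0 := @correlation_variance D w 0 th ltac:(lra) ltac:(lra) wD.
set m := lam * correlation w th in h1 *.
have u0 x : unif_pmf R x = bsc_pmf 0 th x.
  rewrite unif_pmfE bsc_pmfE; apply: eq_bigr => i _.
  by rewrite bsc1E !mul0r addr0 /half mul1r.
have e1 : \sum_x bsc_pmf lam th x * (~~ threshold tau w x)%:R <=
    (2 * #|D|%:R + 2 * (m - 2 * tau) ^+ 2) / tau ^+ 2.
  rewrite ler_pdivlMr // mulr_suml.
  apply: (@le_trans _ _ (expect (bsc_pmf lam th) (fun x =>
     2 * (correlation w x - m) ^+ 2 + 2 * (m - 2 * tau) ^+ 2))); last first.
    rewrite expectD expectZ expect_cst ?sum_bsc_pmf //; lra.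
  apply: ler_sum => x _; rewrite -mulrA; apply: ler_wpM2l.
    by apply: bsc_pmf_ge0; lra.
  rewrite ffunE -ltNge; set z := correlation w x.
  have hs : (z - 2 * tau) ^+ 2 <= 2 * (z - m) ^+ 2 + 2 * (m - 2 * tau) ^+ 2.
    have := sqr_ge0 ((z - m) - (m - 2 * tau)).
    have -> : 2 * (z - m) ^+ 2 + 2 * (m - 2 * tau) ^+ 2 =
      (z - 2 * tau) ^+ 2 + ((z - m) - (m - 2 * tau)) ^+ 2 by ring.
    lra.
  apply: le_trans hs; case: ltP => h; last by rewrite mul0r sqr_ge0.
  rewrite mul1r -[leRHS]sqrrN; apply: lerXn2r; rewrite ?nnegrE; lra.
have e0 : \sum_x unif_pmf R x * (threshold tau w x)%:R <= #|D|%:R / tau ^+ 2.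
  rewrite ler_pdivlMr // mulr_suml; apply: le_trans h0.
  apply: ler_sum => x _; rewrite -mulrA u0; apply: ler_wpM2l.
    by apply: bsc_pmf_ge0; lra.
  rewrite ffunE mul0r subr0; case: (lerP tau) => h; last by rewrite mul0r sqr_ge0.
  rewrite mul1r; apply: lerXn2r; rewrite ?nnegrE; lra.
rewrite /err_h; move: e1 e0; set a := \sum_x _; set b := \sum_x _.
rewrite !mulrDl; lra.
Qed.

(** The threshold is half the typical correlation k lam be of a test point with the votes. The error
    is at most (3/2 + 1) k / tau^2 = 10 / (k lam^2 be^2), whence the requirement 1000. *)
Lemma err_majority_algo n D lam :
  0 < lam -> lam <= 1 -> 0 < majority_bias n lam ->
  1000 <= #|D|%:R * lam ^+ 2 * majority_bias n lam ^+ 2 ->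
  err_alg lam (@majority_algo n D (#|D|%:R * lam * majority_bias n lam / 2)) <= 1 / 100.
Proof.
set be := majority_bias n lam; set k := #|D|%:R => l0 l1 be0 big.
set tau := k * lam * be / 2.
have k0 : 0 < k.
  rewrite lt_neqAle ler0n andbT; apply/eqP => e; move: big.
  rewrite -e !mul0r; lra.
have t0 : 0 < tau by rewrite divr_gt0 // !mulr_gt0.
have t2 : 0 < tau ^+ 2 by rewrite exprn_gt0.
rewrite /err_alg -[leRHS](expect_cst _ (sum_unif_pmf R d)).
apply: ler_expect => th; first exact: unif_pmf_ge0.
rewrite -/(expect (sample_pmf lam th) _).
have p0 (X : sample d n) : 0 <= sample_pmf lam th X by apply: sample_pmf_ge0; lra.
apply: (@le_trans _ _ (expect (sample_pmf lam th) (fun X : sample d n =>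
    tau ^- 2 * (3 / 2 * k + lam ^+ 2 * (correlation (majorities D X) th - k * be) ^+ 2)))).
  apply: ler_expect => // X.
  rewrite (bigD1 (threshold tau (majorities D X))) //= /majority_algo eqxx mul1r.
  rewrite big1 ?addr0 => [|h /negbTE ->]; last by rewrite mul0r.
  apply: le_trans (@err_threshold_le D _ lam th tau t0 (ltW l0) l1 (restrictP _ _)) _.
  rewrite mulrC le_eqVlt; apply/orP; left; apply/eqP; congr (_ * (_ + _)).
  by rewrite -exprMn; congr (_ ^+ 2); rewrite /tau; field.
rewrite expectZ expectD expectZ expect_cst ?sum_sample_pmf //.
have v := @alignment_variance n D lam th (ltW l0) l1.
rewrite -/be -/k in v.
have l21 : lam ^+ 2 <= 1 by apply: exprn_ile1 => //; exact: ltW.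
have : lam ^+ 2 * expect (sample_pmf lam th)
   (fun X : sample d n => (correlation (majorities D X) th - k * be) ^+ 2) <= 1 * k.
  apply: ler_pM => //; first exact: sqr_ge0.
  by apply: expect_ge0 => // X; exact: sqr_ge0.
move=> h; rewrite mulrC ler_pdivrMr //.
have -> : tau ^+ 2 = k * (k * lam ^+ 2 * be ^+ 2) / 4 by rewrite /tau; field.
have := ler_wpM2l (ltW k0) big; lra.
Qed.

(** There are at most 3^|D| possible outputs, and ln 3 <= 2. *)
Lemma memo_le_card n D lam tau : 0 < lam -> lam <= 1 ->
  memo lam (@majority_algo n D tau) <= 2 * #|D|%:R.
Proof.
move=> l0 l1; have aA := @is_algo_majority n D tau.
set M := threshold tau @: restricted_weights D.
have M3 : (#|M| <= 3 ^ #|D|)%N by rewrite -card_restricted_weights leq_imset_card.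
apply: memo_le => th.
pose Q (h : classifier d) : R := if h \in M then #|M|%:R^-1 else 0.
have M0 : (0 < #|M|)%N.
  apply/card_gt0P; exists (threshold tau (restrict D (fun=> None))).
  by apply: imset_f; exact: restrictP.
have M0R : 0 < #|M|%:R :> R by rewrite ltr0n.
have g0 h : h \notin M -> out_marg lam (@majority_algo n D tau) th h = 0.
  by move=> hM; apply: big1 => X _; rewrite (majority_algo_outputs X hM) mulr0.
apply: le_trans (@mi_given_le R d n lam _ l0 l1 aA th Q _ _ _) _.
- by move=> h; rewrite /Q; case: ifP => // _; rewrite invr_ge0 ltW.
- rewrite /Q -big_mkcond /= sumr_const -(mulr_natl _ #|M|) divff //.
  by rewrite pnatr_eq0 -lt0n.
- move=> h; rewrite /Q; case: ifPn => [_ /eqP|/g0 //].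
  by rewrite invr_eq0 (negbTE (lt0r_neq0 M0R)).
apply: (@le_trans _ _ (ln #|M|%:R)).
  have -> : ln #|M|%:R = \sum_h out_marg lam (@majority_algo n D tau) th h * ln #|M|%:R :> R.
    by rewrite -mulr_suml sum_out_marg // mul1r.
  rewrite -sumrN; apply: ler_sum => h _; rewrite /Q.
  case: ifPn => [_|/g0 ->]; last by rewrite !mul0r oppr0.
  by rewrite lnV ?posrE // mulrN opprK.
apply: (@le_trans _ _ (ln (3 ^+ #|D|))).
  by rewrite ler_ln ?posrE ?exprn_gt0 // -natrX ler_nat.
rewrite lnXn // -[leLHS]mulr_natl mulrC; apply: ler_wpM2r => //.
by have := @ln_le_subr1 R 3 ltac:(lra); lra.
Qed.

End MajorityAlgorithm.

(** * Failure probability and parameter choices for the upper bounds *)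

Section UpperBoundParts.
Variable R : realType.
Implicit Types (C lam tau eps : R) (d n : nat).

Lemma prob_majorities_wrong d n (D : {set 'I_d}) lam (th : cube d) :
  (0 < n)%N -> 0 <= lam -> lam <= 1 ->
  expect (sample_pmf lam th)
    (fun X : sample d n => (majorities R D X != restrict D (fun i => Some (th i)))%:R)
  <= d%:R * Num.sqrt (1 - lam ^+ 2) ^+ n.
Proof.
move=> n0 l0 l1; rewrite expect_sample_pmf.
set s := Num.sqrt _.
have k0 i v : 0 <= @column_pmf R n lam (th i) v by apply: column_pmf_ge0; lra.
apply: (@le_trans _ _ (expect (prodm (fun i => @column_pmf R n lam (th i)))
   (fun Y => \sum_i (majority R (Y i) != Some (th i))%:R))).
  apply: ler_expect => [Y|Y]; first exact: prodm_ge0.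
  rewrite majorities_transpose; case: eqP => [_|ne]; first exact: sumr_ge0.
  have [/existsP[i ni]|/existsPn e] := boolP [exists i, majority R (Y i) != Some (th i)].
    by rewrite (bigD1 i) //= ni lerDl; apply: sumr_ge0.
  case: ne; apply/ffunP => i; rewrite !ffunE.
  by have := e i; rewrite negbK => /eqP ->.
rewrite expect_sum.
have -> : d%:R * s ^+ n = \sum_(i < d) s ^+ n by rewrite sumr_const card_ord mulr_natl.
apply: ler_sum => i _.
rewrite (expect_coord_prodm i (fun v => (majority R v != Some (th i))%:R)).
  exact: prob_majority_wrong.
by move=> j; exact: sum_column_pmf.
Qed.

(* Compare the output law with the one that puts mass [1 - eps] on the
   classifier built from the true parameter and spreads [eps] over the others. *)
Lemma memo_le_failure d n (D : {set 'I_d}) lam tau eps :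
  (0 < n)%N -> 0 < lam -> lam <= 1 -> 0 < eps -> eps <= 2^-1 ->
  memo lam (@majority_algo R d n D tau) <=
  2 * eps + d%:R * Num.sqrt (1 - lam ^+ 2) ^+ n * (2 * #|D|%:R - ln eps).
Proof.
move=> n0 l0 l1 e0 e1; have aA := @is_algo_majority R d n D tau.
set M := threshold tau @: restricted_weights D.
have M3 : (#|M| <= 3 ^ #|D|)%N by rewrite -card_restricted_weights leq_imset_card.
apply: memo_le => th.
pose h0 := threshold tau (restrict D (fun i => Some (th i))).
have h0M : h0 \in M by apply: imset_f; exact: restrictP.
pose Q (h : classifier d) : R :=
  if h == h0 then 1 - eps else if h \in M then eps / #|M|%:R else 0.
have M0 : (0 < #|M|)%N by apply/card_gt0P; exists h0.
have M0R : 0 < #|M|%:R :> R by rewrite ltr0n.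
pose g := out_marg lam (@majority_algo R d n D tau) th.
have g0 h : 0 <= g h by apply: out_marg_ge0.
have gM h : h \notin M -> g h = 0.
  by move=> hM; apply: big1 => X _; rewrite (majority_algo_outputs X hM) mulr0.
have g1 : \sum_(h | h != h0) g h = 1 - g h0.
  have e := sum_out_marg lam aA th; rewrite (bigD1 h0) //= -/g in e.
  by rewrite -[in RHS]e addrAC subrr add0r.
have lM : ln #|M|%:R <= 2 * #|D|%:R :> R.
  apply: (@le_trans _ _ (ln (3 ^+ #|D|))).
    by rewrite ler_ln ?posrE ?exprn_gt0 // -natrX ler_nat.
  rewrite lnXn // -[leLHS]mulr_natl mulrC; apply: ler_wpM2r => //.
  by have := @ln_le_subr1 R 3 ltac:(lra); lra.
have lM0 : 0 <= ln #|M|%:R :> R by apply: ln_ge0; rewrite ler1n.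
have le0 : ln eps <= 0 by apply: ln_le0; lra.
apply: le_trans (@mi_given_le R d n lam _ l0 l1 aA th Q _ _ _) _.
- move=> h; rewrite /Q; case: ifP => _; first by lra.
  by case: ifP => // _; apply: divr_ge0 => //; exact: ltW.
- rewrite (bigD1 h0) //= {1}/Q eqxx.
  (* The denominator also counts [h0], so [Q] has total mass below 1, which [mi_given_le] allows. *)
  have : \sum_(h | h != h0) Q h <= \sum_(h in M) eps / #|M|%:R.
    rewrite [leRHS](bigD1 h0) //= -[leLHS]add0r; apply: lerD.
      by apply: divr_ge0; exact: ltW.
    rewrite [leRHS]big_mkcond [leLHS]big_mkcond; apply: ler_sum => h _ /=.
    rewrite /Q; case: (eqVneq h h0) => [_|_] /=; first by rewrite andbF.
    by rewrite andbT.
  rewrite sumr_const -[eps / _ *+ _]mulr_natl mulrC divfK ?lt0r_neq0 //; lra.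
- move=> h; rewrite /Q; case: ifP => [_ /eqP|_].
    by rewrite gt_eqF //; lra.
  case: ifPn => [_ /eqP|hM _]; last exact: gM.
  by rewrite mulf_eq0 invr_eq0 !gt_eqF.
rewrite -/g (bigD1 h0) //= {1}/Q eqxx opprD.
apply: lerD.
  have l2 : - ln (1 - eps) <= 2 * eps.
    rewrite -lnV ?posrE; last by lra.
    apply: (@le_trans _ _ ((1 - eps)^-1 - 1)).
      by apply: ln_le_subr1; rewrite invr_gt0; lra.
    have -> : (1 - eps)^-1 - 1 = eps / (1 - eps) by field; apply: lt0r_neq0; lra.
    rewrite ler_pdivrMr; last by lra.
    have : 0 <= eps * (1 - 2 * eps) by apply: mulr_ge0; lra.
    lra.
  have l3 : 0 <= - ln (1 - eps) by rewrite oppr_ge0; apply: ln_le0; lra.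
  rewrite -mulrN; apply: le_trans l2; rewrite ler_piMl //.
  exact: out_marg_le1.
(* Each output other than [h0] costs at most ln |M| - ln eps, and their joint mass is at most the
   probability of some wrong majority. *)
apply: (@le_trans _ _ ((1 - g h0) * (2 * #|D|%:R - ln eps))).
  rewrite -g1 mulr_suml -sumrN; apply: ler_sum => h hn; rewrite /Q (negbTE hn) -mulrN.
  case: ifPn => [_|/gM ->]; last by rewrite !mul0r.
  apply: ler_wpM2l => //; rewrite ln_div ?posrE //; lra.
apply: ler_wpM2r; first by have : 0 <= #|D|%:R :> R by []; lra.
apply: le_trans (prob_majorities_wrong D th n0 (ltW l0) l1).
rewrite -[X in X - _ <= _](expect_cst 1 (sum_sample_pmf n lam th)) /g out_margE -expectB.
apply: ler_expect => X; first by apply: sample_pmf_ge0; lra.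
rewrite /majority_algo; case: (eqVneq (majorities R D X) _) => [->|_] /=.
  by rewrite eqxx subrr.
by case: (_ == _); rewrite /= ?mulr1n ?mulr0n ?subrr ?subr0.
Qed.

Section Fixed.
Variables (C : R) (d n : nat).
Hypotheses (C0 : 100 <= C) (Cd : C ^+ 4 <= d%:R) (n0 : (0 < n)%N).
Let lam := lam_of C d.
Let Cpos : 0 < C. Proof. by move: C0; lra. Qed.
Let l0 : 0 < lam. Proof. exact: lam_of_gt0. Qed.
Let l1 : lam <= 1. Proof. exact: lam_of_le1. Qed.
Let n1 : 1 <= n%:R :> R. Proof. by rewrite ler1n. Qed.
Let d0 : 0 < d%:R :> R. Proof. by apply: lt_le_trans Cd; rewrite exprn_gt0. Qed.
Let sd0 : 0 < Num.sqrt (d%:R : R). Proof. by rewrite sqrtr_gt0. Qed.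
Let sqd : Num.sqrt (d%:R : R) ^+ 2 = d%:R. Proof. by rewrite sqr_sqrtr // ltW. Qed.
Let C2 : 100 * 100 <= C ^+ 2.
Proof. by rewrite expr2; apply: ler_pM. Qed.
Let lam2 : lam ^+ 2 * Num.sqrt (d%:R : R) = C ^+ 2. Proof. exact: lam_of2. Qed.
Let lam4 : lam ^+ 4 * d%:R = C ^+ 4. Proof. exact: lam_of4. Qed.

Lemma dim_ge : 100 * 100 <= Num.sqrt (d%:R : R).
Proof.
apply: (le_trans C2); rewrite -(ler_pM2l (exprn_gt0 2 l0)) lam2.
by rewrite ler_piMl ?sqr_ge0 // exprn_ile1 // ltW.
Qed.

(** With k = floor (d / n) >= d / (2 n), both alternatives of [majority_bias_ge] give enough signal:
    k lam^2 >= C^2 / 2 when the bias is at least 1/2, and k lam^4 n >= C^4 / 2 when it is of order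
    lam sqrt n. *)
Lemma majority_algo_small :
  n%:R <= Num.sqrt (d%:R : R) ->
  exists A : sample d n -> classifier d -> R,
    is_algo A /\ err_alg lam A <= 1 / 100 /\ memo lam A <= 2 * d%:R / n%:R.
Proof.
move=> nd; pose k := (d %/ n)%N.
have dg := dim_ge.
have nd' : (n <= d)%N.
  rewrite -(ler_nat R) -sqd; apply: (le_trans nd); rewrite expr2 ler_peMr ?ltW //.
  lra.
have k1 : (0 < k)%N by rewrite divn_gt0.
have kd : (k <= d)%N by apply: leq_div.
have kn : k%:R * n%:R <= d%:R :> R by rewrite -natrM ler_nat leq_divM.
have kn2 : d%:R <= 2 * (k%:R * n%:R) :> R.
  rewrite -natrM -[2]/(2%:R) -natrM ler_nat.
  have := ltn_ceil d n0; rewrite -/k => /ltnW h; apply: (leq_trans h).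
  by rewrite mulnA leq_mul2r mul2n -addnn -addn1 leq_add2l k1 orbT.
pose D : {set 'I_d} := [set i in take k (enum 'I_d)].
have Dk : #|D| = k.
  rewrite cardsE; apply: etrans (card_uniqP (take_uniq _ (enum_uniq _))) _.
  by rewrite size_takel // size_enum_ord.
have x0 : 0 < Num.sqrt (d%:R : R) by [].
have h2 : 4000 <= k%:R * lam ^+ 2.
  have : d%:R * lam ^+ 2 <= 2 * (k%:R * n%:R) * lam ^+ 2.
    by apply: ler_wpM2r => //; apply: sqr_ge0.
  have -> : d%:R * lam ^+ 2 = C ^+ 2 * Num.sqrt (d%:R : R).
    by rewrite -lam2 -{1}sqd; ring.
  have kl0 : 0 <= k%:R * lam ^+ 2 by apply: mulr_ge0 => //; apply: sqr_ge0.
  have := ler_wpM2l kl0 nd.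
  move=> h3 h4; have : C ^+ 2 * Num.sqrt (d%:R : R) <= 2 * (k%:R * lam ^+ 2) * Num.sqrt (d%:R : R).
    by move: h3 h4; lra.
  by rewrite ler_pM2r //; move: C2; lra.
have h4 : C ^+ 4 / 2 <= k%:R * lam ^+ 4 * n%:R.
  have l40 : 0 <= lam ^+ 4 by apply: exprn_ge0; exact: ltW.
  have := ler_wpM2l l40 kn2; rewrite lam4; lra.
have C4 : 1600 * 1000 <= C ^+ 4 / 2.
  have -> : C ^+ 4 = C ^+ 2 * C ^+ 2 by ring.
  have := @ler_pM R (100 * 100) (C ^+ 2) (100 * 100) (C ^+ 2) ltac:(lra) ltac:(lra) C2 C2; lra.
have [be0 big] : 0 < majority_bias n lam /\ 1000 <= k%:R * lam ^+ 2 * majority_bias n lam ^+ 2.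
  have [b|b] := majority_bias_ge n0 (ltW l0) l1.
    split; first by lra.
    have : 2^-1 ^+ 2 <= majority_bias n lam ^+ 2 by apply: lerXn2r; rewrite ?nnegrE; lra.
    have kl0 : 0 <= k%:R * lam ^+ 2 by lra.
    by move=> /(ler_wpM2l kl0); lra.
  have q0 : 0 < lam * Num.sqrt n%:R / 40.
    by rewrite divr_gt0 // mulr_gt0 // sqrtr_gt0 ltr0n.
  split; first exact: lt_le_trans b.
  have : (lam * Num.sqrt n%:R / 40) ^+ 2 <= majority_bias n lam ^+ 2.
    by apply: lerXn2r => //; rewrite nnegrE ltW // (lt_le_trans q0).
  have kl0 : 0 <= k%:R * lam ^+ 2 by lra.
  move=> /(ler_wpM2l kl0).
  have -> : k%:R * lam ^+ 2 * (lam * Num.sqrt n%:R / 40) ^+ 2 =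
     k%:R * lam ^+ 4 * (Num.sqrt n%:R ^+ 2) / 1600 by field.
  rewrite sqr_sqrtr //; lra.
have eA := @err_majority_algo R d n D lam l0 l1 be0.
rewrite Dk in eA; have := eA big => {}eA.
exists (@majority_algo R d n D (k%:R * lam * majority_bias n lam / 2)); split.
  exact: is_algo_majority.
split=> //; apply: (le_trans (memo_le_card _ _ _ l0 l1)).
by rewrite Dk -mulrA ler_wpM2l // ler_pdivlMr // ltr0n.
Qed.

(** From 1 - lam^2 <= exp (- lam^2) and lam^2 n = C^2 n / sqrt d. The factor 2 in the exponent
    brings the bound below 1/4 as soon as n >= sqrt d. *)
Lemma sqrt_pow_le_expR :
  Num.sqrt (1 - lam ^+ 2) ^+ n <= expR (- (2 * (n%:R / Num.sqrt (d%:R : R)))).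
Proof.
have p0 : 0 <= 1 - lam ^+ 2 by rewrite subr_ge0 exprn_ile1 // ltW.
rewrite -ler_sqr ?nnegrE ?expR_ge0 ?exprn_ge0 ?sqrtr_ge0 //.
rewrite -exprM mulnC exprM sqr_sqrtr // -expRM_natl.
apply: (@le_trans _ _ (expR (- lam ^+ 2) ^+ n)).
  by apply: lerXn2r; rewrite ?nnegrE ?expR_ge0 //; exact: expR_ge1Dx.
rewrite -expRM_natl ler_expR.
have -> : n%:R * - lam ^+ 2 = - (C ^+ 2 * (n%:R / Num.sqrt (d%:R : R))).
  by rewrite -lam2; field; exact: lt0r_neq0.
have : 0 <= n%:R / Num.sqrt (d%:R : R) by apply: divr_ge0 => //; exact: ltW.
move: (n%:R / _) => x x0.
have : 100 * 100 * x <= C ^+ 2 * x by apply: ler_wpM2r.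
lra.
Qed.

Lemma majority_algo_large :
  Num.sqrt (d%:R : R) <= n%:R ->
  exists A : sample d n -> classifier d -> R,
    is_algo A /\ err_alg lam A <= 1 / 100 /\
    memo lam A <= 5 * d%:R ^+ 2 * n%:R * expR (- (n%:R / Num.sqrt (d%:R : R))).
Proof.
move=> dn; set x := n%:R / Num.sqrt (d%:R : R).
have x1 : 1 <= x by rewrite ler_pdivlMr // mul1r.
have dg := dim_ge.
have d1 : 1 <= d%:R :> R.
  by rewrite -sqd expr2; apply: mulr_ege1; lra.
have sn := sqrt_pow_le_expR; rewrite -/x in sn.
have s4 : Num.sqrt (1 - lam ^+ 2) ^+ n <= 4^-1.
  apply: (le_trans sn).
  rewrite expRN lef_pV2 ?posrE ?expR_gt0 //.
  have := expR_ge1Dx x => h; rewrite (_ : 2 * x = x + x) ?expRD; last by ring.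
  have := @ler_pM R 2 (expR x) 2 (expR x) ltac:(lra) ltac:(lra) ltac:(lra) ltac:(lra); lra.
have b := majority_bias_ge_prob n0 (ltW l0) l1.
have bh : 2^-1 <= majority_bias n lam by lra.
have big : 1000 <= d%:R * lam ^+ 2 * majority_bias n lam ^+ 2.
  have : 2^-1 ^+ 2 <= majority_bias n lam ^+ 2 by apply: lerXn2r; rewrite ?nnegrE; lra.
  have kl : 4000 <= d%:R * lam ^+ 2.
    have -> : d%:R * lam ^+ 2 = C ^+ 2 * Num.sqrt (d%:R : R).
      by rewrite -lam2 -{1}sqd; ring.
    have := @ler_pM R (100 * 100) (C ^+ 2) 1 (Num.sqrt d%:R) ltac:(lra) ltac:(lra) C2 ltac:(lra).
    lra.
  have kl0 : 0 <= d%:R * lam ^+ 2 by lra.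
  by move=> /(ler_wpM2l kl0); lra.
pose D : {set 'I_d} := [set: 'I_d].
have Dk : #|D| = d by rewrite cardsT card_ord.
have eA := @err_majority_algo R d n D lam l0 l1 ltac:(lra).
rewrite Dk in eA; have := eA big => {}eA.
exists (@majority_algo R d n D (d%:R * lam * majority_bias n lam / 2)); split.
  exact: is_algo_majority.
split=> //.
have ex0 := expR_gt0 (- x).
have ex1 : expR (- x) <= 1 by rewrite expR_le1; lra.
(* This [eps] matches the failure bound, and - ln eps = x + ln 2 adds at most n + 1 to the cost 2
   d. *)
apply: (le_trans (@memo_le_failure d n D lam _ (expR (- x) / 2) n0 l0 l1 ltac:(lra) ltac:(lra))).
rewrite Dk ln_div ?posrE // expRK.
have l2 : ln 2 <= 1 :> R by have := @ln_le_subr1 R 2 ltac:(lra); lra.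
have xn : x <= n%:R by rewrite /x ler_pdivrMr // ler_peMr //; lra.
have sn' : Num.sqrt (1 - lam ^+ 2) ^+ n <= expR (- x).
  by apply: (le_trans sn); rewrite ler_expR; lra.
have s0 : 0 <= Num.sqrt (1 - lam ^+ 2) ^+ n by rewrite exprn_ge0 // sqrtr_ge0.
have hd : d%:R * Num.sqrt (1 - lam ^+ 2) ^+ n * (2 * d%:R - (- x - ln 2)) <=
   d%:R * expR (- x) * (2 * d%:R + n%:R + 1).
  have ln20 : 0 <= ln 2 :> R by apply: ln_ge0; lra.
  apply: ler_pM; [by apply: mulr_ge0|by lra|by apply: ler_wpM2l|by lra].
have q : d%:R * (2 * d%:R + n%:R + 1) <= 4 * (d%:R ^+ 2 * n%:R) :> R.
  have a1 : d%:R * d%:R * 1 <= d%:R * d%:R * n%:R :> R by apply: ler_wpM2l => //; apply: mulr_ge0.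
  have a2 : d%:R * n%:R * 1 <= d%:R * n%:R * d%:R :> R by apply: ler_wpM2l => //; apply: mulr_ge0.
  have a3 : d%:R * 1 <= d%:R * d%:R :> R by apply: ler_wpM2l.
  lra.
have := ler_wpM2l (ltW ex0) q.
have q1 : 1 <= d%:R ^+ 2 * n%:R :> R.
  by apply: mulr_ege1 => //; apply: exprn_ege1.
have := ler_wpM2l (ltW ex0) q1.
lra.
Qed.

(** Below sqrt d the exponential is at least 1/4, so the bound 2 d / n of [majority_algo_small] is
    already stronger. *)
Lemma majority_algo_memo :
  exists A : sample d n -> classifier d -> R,
    is_algo A /\ err_alg lam A <= 1 / 100 /\
    memo lam A <= 8 * d%:R ^+ 2 * n%:R * expR (- (n%:R / Num.sqrt (d%:R : R))).
Proof.
have p0 : 0 <= d%:R ^+ 2 * n%:R :> R by apply: mulr_ge0 => //; apply: exprn_ge0.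
have [dn|/ltW nd] := lerP (Num.sqrt (d%:R : R)) n%:R.
  have [A [aA [eA mA]]] := majority_algo_large dn; exists A; do !split => //.
  apply: (le_trans mA); apply: ler_wpM2r; first exact: expR_ge0.
  lra.
have [A [aA [eA mA]]] := majority_algo_small nd; exists A; do !split => //.
apply: (le_trans mA).
have x1 : n%:R / Num.sqrt (d%:R : R) <= 1 by rewrite ler_pdivrMr // mul1r.
have e4 : 4^-1 <= expR (- (n%:R / Num.sqrt (d%:R : R))).
  apply: (@le_trans _ _ (expR (- 1))); last by rewrite ler_expR; lra.
  rewrite expRN lef_pV2 ?posrE ?expR_gt0 //.
  have := @expR_mul_le R 2^-1 ltac:(lra) => h.
  rewrite (_ : 1 = 2^-1 + 2^-1) ?expRD; last by lra.
  have g0 := expR_gt0 (2^-1 : R).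
  by have := @ler_pM R (expR 2^-1) 2 (expR 2^-1) 2 ltac:(lra) ltac:(lra) ltac:(lra) ltac:(lra); lra.
apply: (@le_trans _ _ (8 * d%:R ^+ 2 * n%:R * 4^-1)); last first.
  by apply: ler_wpM2l => //; lra.
have dg := dim_ge.
have d1 : 1 <= d%:R :> R by rewrite -sqd expr2; apply: mulr_ege1; lra.
rewrite ler_pdivrMr; last by rewrite ltr0n.
have a1 : d%:R * 1 <= d%:R * d%:R :> R by apply: ler_wpM2l.
have a2 : d%:R * d%:R * 1 <= d%:R * d%:R * (n%:R * n%:R) :> R.
  by apply: ler_wpM2l; [apply: mulr_ge0|apply: mulr_ege1].
have a3 := le_trans a1 _; lra.
Qed.

End Fixed.

(** With x = n / sqrt d, half of the exponent absorbs the factor x, since x e^(-x) <= 2 e^(-x/2).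
    The other half is at most d^-(4+k), which beats the remaining prefactor, at most d^4. *)
Lemma majority_algo_poly C d n (k : R) : 100 <= C -> C ^+ 4 <= d%:R -> 0 < k ->
  2 * (4 + k) * Num.sqrt (d%:R : R) * ln (d%:R : R) <= n%:R ->
  exists A : sample d n -> classifier d -> R,
    is_algo A /\ err_alg (lam_of C d) A <= 1 / 100 /\
    memo (lam_of C d) A <= powR (d%:R : R) (- k).
Proof.
move=> C0 Cd k0 hn; have Cpos : 0 < C by lra.
have dg := dim_ge C0 Cd.
set q := Num.sqrt (d%:R : R) in dg hn *.
have q0 : 0 < q by lra.
have q2 : q ^+ 2 = d%:R by rewrite sqr_sqrtr.
have d16 : 16 <= d%:R :> R.
  rewrite -q2 expr2.
  by have := @ler_pM R 4 q 4 q ltac:(lra) ltac:(lra) ltac:(lra) ltac:(lra); lra.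
have l0 : 0 < ln (d%:R : R) by apply: ln_gt0; lra.
have n0 : (0 < n)%N.
  rewrite -(ltr0n R); apply: lt_le_trans hn.
  by apply: mulr_gt0 => //; apply: mulr_gt0 => //; lra.
have [A [aA [eA mA]]] := majority_algo_memo C0 Cd n0.
exists A; do !split => //; apply: (le_trans mA); rewrite -/q.
set x := n%:R / q.
have xl : 2 * (4 + k) * ln (d%:R : R) <= x by rewrite ler_pdivlMr // mulrAC.
have nE : n%:R = q * x by rewrite /x mulrC divfK // lt0r_neq0.
have x0 : 0 <= x by apply: divr_ge0 => //; lra.
have qd : q <= d%:R by rewrite -q2 expr2 ler_peMr; lra.
have dE : d%:R = expR (ln d%:R) :> R by rewrite lnK // posrE; lra.
have e2 : x * expR (- x) <= 2 * expR (- (x / 2)).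
  have -> : expR (- x) = expR (- (x / 2)) * expR (- (x / 2)).
    by rewrite -expRD; congr expR; field.
  rewrite mulrA; apply: ler_wpM2r; first exact: expR_ge0.
  have := expR_ge1Dx (x / 2) => h.
  rewrite expRN ler_pdivrMr ?expR_gt0 //; lra.
have m1 : 8 * d%:R ^+ 2 * n%:R * expR (- x) <= d%:R ^+ 4 * expR (- (x / 2)).
  rewrite nE; have -> : 8 * d%:R ^+ 2 * (q * x) * expR (- x) =
    8 * d%:R ^+ 2 * q * (x * expR (- x)) by ring.
  apply: (@le_trans _ _ (8 * d%:R ^+ 2 * q * (2 * expR (- (x / 2))))).
    by apply: ler_wpM2l => //; do 2?apply: mulr_ge0 => //; [exact: exprn_ge0|lra].
  have -> : 8 * d%:R ^+ 2 * q * (2 * expR (- (x / 2))) =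
    16 * q * d%:R ^+ 2 * expR (- (x / 2)) by ring.
  apply: ler_wpM2r; first exact: expR_ge0.
  have -> : d%:R ^+ 4 = d%:R * d%:R * d%:R ^+ 2 :> R by ring.
  by apply: ler_wpM2r; [exact: exprn_ge0|apply: ler_pM; lra].
apply: (le_trans m1); rewrite /powR gt_eqF; last by lra.
rewrite {1}dE -expRM_natl -expRD ler_expR; lra.
Qed.

End UpperBoundParts.

Theorem mainTheorem10 (R : realType) :
  exists C0 : R, 0 < C0 /\ forall C : R, C0 <= C ->
  (* (1) one sample suffices for error 0.01 *)
  (forall d : nat, C ^+ 4 <= d%:R ->
     exists A : sample d 1 -> classifier d -> R,
       is_algo A /\ err_alg (lam_of C d) A <= 1 / 100)
  /\
  (* (2) main lower bound *)
  (exists c : R, 0 < c /\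
   forall (d n : nat) (M : {set classifier d}) (A : sample d n -> classifier d -> R)
          (alpha : R),
     C ^+ 4 <= d%:R -> (0 < n)%N -> 0 < alpha -> alpha < 1 / 2 ->
     is_algo A -> outputs_in A M -> err_alg (lam_of C d) A <= alpha ->
     let lam := lam_of C d in
     let L := ln (d%:R * n%:R * ln (#|M|%:R) / C_alpha alpha) in
     c * ((1 - 8 * lam ^+ 2 * n%:R * L) / (lam ^+ 4 * n%:R * L) * C_alpha alpha)
       <= memo lam A)
  /\
  (* (2) in particular, small n and |M| <= exp(d^Ct) *)
  (forall Ct : R, 0 < Ct -> exists c' c : R, 0 < c' /\ 0 < c /\
   forall (d n : nat) (M : {set classifier d}) (A : sample d n -> classifier d -> R)
          (alpha : R),
     C ^+ 4 <= d%:R -> (0 < n)%N -> 0 < alpha -> alpha < 1 / 2 ->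
     is_algo A -> outputs_in A M -> err_alg (lam_of C d) A <= alpha ->
     n%:R <= c' * Num.sqrt (d%:R : R) / ln (d%:R * ln (#|M|%:R) / C_alpha alpha) ->
     #|M|%:R <= expR (powR (d%:R : R) Ct) ->
     let lam := lam_of C d in
     let L := ln (d%:R * n%:R / C_alpha alpha) in
     c * ((1 - 8 * lam ^+ 2 * n%:R * L) / (lam ^+ 4 * n%:R * L) * C_alpha alpha)
       <= memo lam A)
  /\
  (* (2) for alpha = 1/3 the bound is ~Omega(d/n) *)
  (forall Ct : R, 0 < Ct -> exists (c' c : R) (k : nat), 0 < c' /\ 0 < c /\
   forall (d n : nat) (M : {set classifier d}) (A : sample d n -> classifier d -> R),
     C ^+ 4 <= d%:R -> (0 < n)%N ->
     is_algo A -> outputs_in A M -> err_alg (lam_of C d) A <= 1 / 3 ->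
     n%:R <= c' * Num.sqrt (d%:R : R) / ln (d%:R * ln (#|M|%:R) / C_alpha (1 / 3)) ->
     #|M|%:R <= expR (powR (d%:R : R) Ct) ->
     c * d%:R / (n%:R * ln (d%:R : R) ^+ k) <= memo (lam_of C d) A)
  /\
  (* (3) upper bound O(d/n) for n <= sqrt d *)
  (exists K : R, 0 < K /\
   forall d n : nat, C ^+ 4 <= d%:R -> (0 < n)%N -> n%:R <= Num.sqrt (d%:R : R) ->
     exists A : sample d n -> classifier d -> R,
       is_algo A /\ err_alg (lam_of C d) A <= 1 / 100 /\
       memo (lam_of C d) A <= K * d%:R / n%:R)
  /\
  (* (3) upper bound O(d^2 n exp(-n/sqrt d)) for every n *)
  (exists K : R, 0 < K /\
   forall d n : nat, C ^+ 4 <= d%:R -> (0 < n)%N ->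
     exists A : sample d n -> classifier d -> R,
       is_algo A /\ err_alg (lam_of C d) A <= 1 / 100 /\
       memo (lam_of C d) A <= K * d%:R ^+ 2 * n%:R * expR (- (n%:R / Num.sqrt (d%:R : R))))
  /\
  (* (3) in particular, n >~ sqrt d log d gives memorization 1/poly(d) *)
  (forall k : R, 0 < k -> exists a : R, 0 < a /\
   forall d n : nat, C ^+ 4 <= d%:R ->
     a * Num.sqrt (d%:R : R) * ln (d%:R : R) <= n%:R ->
     exists A : sample d n -> classifier d -> R,
       is_algo A /\ err_alg (lam_of C d) A <= 1 / 100 /\
       memo (lam_of C d) A <= powR (d%:R : R) (- k)).
Proof.
(* Large enough for both halves: the upper bounds ask for 100, the lower bounds for e^30. *)
exists (expR 100); split; first exact: expR_gt0.
move=> C hC; have C100 : 100 <= C by apply: le_trans hC; have := expR_ge1Dx (100 : R); lra.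
have C30 : expR 30 <= C by apply: le_trans hC; rewrite ler_expR; lra.
have C0 : 0 < C by lra.
have i0 := info_const_gt0 R.
split.
  move=> d Cd; have dg := dim_ge C100 Cd.
  have [|A [aA [eA _]]] := @majority_algo_small R C d 1 C100 Cd isT; first by lra.
  by exists A.
split.
  exists (info_const R / 11520); split; first by rewrite divr_gt0.
  by move=> d n M A alpha Cd n0 a0 a1 aA AM eA; exact: memo_lower_bound AM _.
split.
  move=> Ct _; exists (info_const R / (11520 * C ^+ 2)), (info_const R / 11520).
  split; first by rewrite divr_gt0 // mulr_gt0 // exprn_gt0.
  split; first by rewrite divr_gt0.
  move=> d n M A alpha Cd n0 a0 a1 aA AM eA nsmall _.
  exact: memo_lower_bound_small AM _ nsmall.
split.
  move=> Ct _; have c0 : 0 < C_alpha (1 / 3 : R) by apply: C_alpha_gt0; lra.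
  (* The exponent 0 means that the bound d / n holds without logarithmic loss; lam^4 d = C^4
     converts 1 / (lam^4 n) into it. *)
  exists (info_const R / (11520 * C ^+ 2)),
    (info_const R / 11520 * (2 / C ^+ 4 * C_alpha (1 / 3))), 0%N.
  split; first by rewrite divr_gt0 // mulr_gt0 // exprn_gt0.
  split.
    apply: mulr_gt0; first exact: divr_gt0.
    by apply: mulr_gt0 => //; apply: divr_gt0 => //; exact: exprn_gt0.
  move=> d n M A Cd n0 aA AM eA nsmall _; rewrite expr0 mulr1.
  by apply: memo_lower_bound_dim AM _ nsmall => //; lra.
split.
  exists 2; split => // d n Cd n0 nd.
  exact: majority_algo_small.
split.
  exists 8; split => // d n Cd n0.
  exact: majority_algo_memo.
move=> k k0; exists (2 * (4 + k)); split; first by lra.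
by move=> d n Cd hn; exact: majority_algo_poly.
Qed.
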